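(* The bivariate $f$-polynomial of the family of double cycle hypercube graph associahedra is \[ f^{DC}(x,y)=1+(xy+2y)f^B+2y\left[(1+yD_y)f^A\right](f^C-1), \] where $f^A$ is the bivariate $f$-polynomial of the family of associahedra, $f^B$ is the bivariate $f$-polynomial of the family of cyclohedra, $f^C$ is the bivariate $f$-polynomial of the cis double path graph, and $D_y=\partial/\partial y$. This function restricted to $x=0$ gives the generating function for the number of vertices of each polytope: \[ f^{DC}(0,y)=1+\frac{1-\sqrt{1-4y}-2y}{1-4y}+\frac{2y}{\sqrt{1-4y}} . \]
   Context: For a family of $n$-dimensional polytopes $P_n$, $n\ge0$ ($P_0$ a point), the bivariate $f$-polynomial is $\sum_{n,k\ge0}f_k(P_n)x^ky^n$, with $f_k(P_n)$ the number of $k$-dimensional faces. Identities are of formal power series; square roots have constant term $1$. Let $\pm[n]=\{-n,\dots,-1,1,\dots,n\}$. For a graph on a subset of $\pm[n]$, a tube is a nonempty set of vertices inducing a connected subgraph and containing no pair $\{i,-i\}$. Two tubes are weakly compatible if one is contained in the other, or they are disjoint with no edge between them. A tubing is a set of pairwise weakly compatible tubes whose union contains no pair $\{i,-i\}$. The hypercube graph associahedron of a graph on $\pm[n]$ is the simple $n$-dimensional polytope whose dual simplicial complex is isomorphic to the complex of tubings (so $k$-dimensional faces correspond to tubings with $n-k$ tubes). The double cycle hypercube graph is the graph on $\pm[n]$ with edges $\{i,i+1\}$, $\{-i,-(i+1)\}$ for $1\le i<n$, and $\{1,n\}$, $\{-1,-n\}$ (for $n=1$ there are no edges). The cis double path graph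 $C_n$, $n\ge1$, is the graph on $\pm[n]\setminus\{-1,-n\}$ induced from the double path graph, which has edges $\{i,i+1\}$ and $\{-i,-(i+1)\}$, $1\le i<n$. Its bivariate $f$-polynomial is $f^C=1+\sum_{n\ge1}\sum_{k}c_{n,k}x^{n-k}y^n$, where $c_{n,k}$ is the number of tubings of $C_n$ with $k$ tubes (this is the count of $(n-k)$-dimensional faces of the corresponding pointed $n$-dimensional simple polyhedron). The $n$-dimensional associahedron (resp. cyclohedron) is the simple polytope whose $(n-k)$-dimensional faces correspond to sets of $k$ pairwise compatible tubes of the path (resp. cycle) on $n+1$ vertices, where here a tube is a nonempty proper vertex subset inducing a connected subgraph, and two tubes are compatible if one contains the other or they are disjoint and non-adjacent. *)

(* Defs.v *)
From HB Require Import structures.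
From mathcomp Require Import all_boot all_order all_algebra finmap.
From mathcomp Require Import all_classical all_reals.

Set Implicit Arguments.
Unset Strict Implicit.
Unset Printing Implicit Defensive.

Import Order.TTheory GRing.Theory Num.Theory.

Local Open Scope ring_scope.

(* A record rather than an alias of [nat -> R], because functions already carry
   the pointwise ring structure. *)
Record fps (R : Type) := Fps { fps_coef :> nat -> R }.

HB.instance Definition _ (R : Type) := gen_eqMixin (fps R).
HB.instance Definition _ (R : Type) := gen_choiceMixin (fps R).

Lemma fpsP (R : Type) (f g : fps R) : f =1 g <-> f = g.
Proof. by split=> [|->//]; case: f g => [f] [g] /= /funext ->. Qed.

Section FpsZmod.
Variable R : comNzRingType.
Implicit Types f g h : fps R.

Definition fps_zero : fps R := Fps (fun=> 0).
Definition fps_add f g : fps R := Fps (fun n => f n + g n).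
Definition fps_opp f : fps R := Fps (fun n => - f n).

Fact fps_addA : associative fps_add.
Proof. by move=> f g h; apply/fpsP => n /=; rewrite addrA. Qed.
Fact fps_addC : commutative fps_add.
Proof. by move=> f g; apply/fpsP => n /=; rewrite addrC. Qed.
Fact fps_add0 : left_id fps_zero fps_add.
Proof. by move=> f; apply/fpsP => n /=; rewrite add0r. Qed.
Fact fps_addN : left_inverse fps_zero fps_opp fps_add.
Proof. by move=> f; apply/fpsP => n /=; rewrite addNr. Qed.

HB.instance Definition _ :=
  GRing.isZmodule.Build (fps R) fps_addA fps_addC fps_add0 fps_addN.

Definition fpsC (c : R) : fps R := Fps (fun n => if n == 0%N then c else 0).
Definition fps_mul f g : fps R :=
  Fps (fun n => \sum_(i < n.+1) f i * g (n - i)%N).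

Definition fps_trunc m f : {poly R} := \poly_(i < m) f i.

Lemma fps_mul_trunc m f g n : (n < m)%N ->
  fps_mul f g n = (fps_trunc m f * fps_trunc m g)`_n.
Proof.
move=> nm; rewrite coefM /=; apply: eq_bigr => i _.
have im : (i < m)%N := leq_trans (ltn_ord i) nm.
have nim : (n - i < m)%N := leq_ltn_trans (leq_subr i n) nm.
by rewrite !coef_poly im nim.
Qed.

Fact fps_mulC : commutative fps_mul.
Proof.
by move=> f g; apply/fpsP => n; rewrite !(fps_mul_trunc (m := n.+1))// mulrC.
Qed.

Fact fps_mulA : associative fps_mul.
Proof.
move=> f g h; apply/fpsP => n.
have eqtr a b i : (i < n.+1)%N ->
  fps_mul a b i = (fps_trunc n.+1 a * fps_trunc n.+1 b)`_i.
  exact: fps_mul_trunc.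
transitivity ((fps_trunc n.+1 f * (fps_trunc n.+1 g * fps_trunc n.+1 h))`_n).
  rewrite coefM; apply: eq_bigr => i _.
  by rewrite coef_poly ltn_ord eqtr// ltnS leq_subr.
rewrite mulrA coefM; apply: eq_bigr => i _.
by rewrite -eqtr// coef_poly ltnS leq_subr.
Qed.

Fact fps_mul1 : left_id (fpsC 1) fps_mul.
Proof.
move=> f; apply/fpsP => n /=; rewrite big_ord_recl /= mul1r subn0.
by rewrite big1 ?addr0// => i _; rewrite mul0r.
Qed.

Fact fps_mulDl : left_distributive fps_mul fps_add.
Proof.
move=> f g h; apply/fpsP => n /=; rewrite -big_split /=.
by apply: eq_bigr => i _; rewrite mulrDl.
Qed.

Fact fps_oner_neq0 : fpsC 1 != fps_zero.
Proof. by apply/eqP => /fpsP/(_ 0%N)/eqP; rewrite /= oner_eq0. Qed.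

HB.instance Definition _ := GRing.Zmodule_isComNzRing.Build (fps R)
  fps_mulA fps_mulC fps_mul1 fps_mulDl fps_oner_neq0.

Definition fpsX : fps R := Fps (fun n => if n == 1%N then 1 else 0).

Definition fps_deriv f : fps R := Fps (fun n => f n.+1 *+ n.+1).

Lemma fps_coef0 n : (0 : fps R) n = 0. Proof. by []. Qed.
Lemma fps_coef1 n : (1 : fps R) n = (n == 0%N)%:R.
Proof. by case: n. Qed.
Lemma fps_coefD f g n : (f + g) n = f n + g n. Proof. by []. Qed.
Lemma fps_coefN f n : (- f) n = - f n. Proof. by []. Qed.
Lemma fps_coefB f g n : (f - g) n = f n - g n. Proof. by []. Qed.
Lemma fps_coefM f g n : (f * g) n = \sum_(i < n.+1) f i * g (n - i)%N.
Proof. by []. Qed.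
Lemma fps_coefM0 f g : (f * g) 0%N = f 0%N * g 0%N.
Proof. by rewrite fps_coefM big_ord1. Qed.
Lemma fps_coefCM c f n : (fpsC c * f) n = c * f n.
Proof.
rewrite fps_coefM big_ord_recl /= subn0 (_ : \sum_(i < n) _ = 0) ?addr0//.
by apply: big1 => i _; rewrite /= mul0r.
Qed.
Lemma fpsCM c d : fpsC c * fpsC d = fpsC (c * d) :> fps R.
Proof. by apply/fpsP => -[|n]; rewrite fps_coefCM //= mulr0. Qed.
Lemma fps_coef_sum (I : Type) (r : seq I) (P : pred I) (F : I -> fps R) n :
  (\sum_(i <- r | P i) F i) n = \sum_(i <- r | P i) F i n.
Proof. by elim/big_rec2: _ => //= i y1 y2 _ <-. Qed.

Lemma fps_coefX_small f k n : f 0%N = 0 -> (n < k)%N -> (f ^+ k) n = 0.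
Proof.
move=> f0; elim: k n => // k IH n nk.
rewrite exprS fps_coefM big1// => -[[|i] /= il] _; first by rewrite f0 mul0r.
by rewrite IH ?mulr0//; case: n il nk => // n; rewrite !ltnS subSS => il nk;
   exact: leq_ltn_trans (leq_subr _ _) _.
Qed.

End FpsZmod.

Arguments fpsX {R}.

Definition fps_map (R S : Type) (phi : R -> S) (f : fps R) : fps S :=
  Fps (fun n => phi (f n)).

Section FpsUnit.
Variable R : comUnitRingType.
Implicit Types f g h : fps R.

Definition fps_unit : {pred fps R} := fun f => f 0%N \is a GRing.unit.

(* With c = f 0 and g = 1 - c^-1 f, which has no constant term, this is the
   geometric series f^-1 = c^-1 (1 + g + g^2 + ...). *)
Definition fps_inv f : fps R :=
  if f 0%N \is a GRing.unit then
    Fps (fun n => (f 0%N)^-1 *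
      \sum_(k < n.+1) ((1 - fpsC (f 0%N)^-1 * f) ^+ k) n)
  else f.

Fact fps_mulVr : {in fps_unit, left_inverse 1 fps_inv *%R}.
Proof.
move=> f; rewrite unfold_in /= => fu; rewrite /fps_inv fu.
set c := f 0%N; set g := 1 - fpsC c^-1 * f.
have g0 : g 0%N = 0.
  by rewrite fps_coefB fps_coefM0 fps_coef1 /= mulVr ?subrr.
have fE : f = fpsC c * (1 - g).
  by rewrite opprB addrC subrK mulrA fpsCM mulrV// mul1r.
apply/fpsP => n.
transitivity ((fpsC c^-1 * (\sum_(k < n.+1) g ^+ k) * f) n).
  rewrite !fps_coefM; apply: eq_bigr => i _; congr (_ * _).
  rewrite fps_coefCM; congr (_ * _); rewrite fps_coef_sum.
  rewrite (big_ord_widen n.+1 (fun k => (g ^+ k) i) (ltn_ord i)).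
  rewrite big_mkcond /=; apply: eq_bigr => k _.
  by case: ltnP => // ik; rewrite fps_coefX_small.
have -> : fpsC c^-1 * (\sum_(k < n.+1) g ^+ k) * f = 1 - g ^+ n.+1.
  rewrite fE mulrACA fpsCM mulVr// mul1r mulrC.
  rewrite -[in RHS](expr1n (fps R) n.+1) subrXX.
  by congr (_ * _); apply: eq_bigr => i _; rewrite expr1n mul1r.
by rewrite fps_coefB fps_coefX_small// subr0.
Qed.

Fact fps_unitPl f g : g * f = 1 -> fps_unit f.
Proof.
move/fpsP/(_ 0%N); rewrite fps_coefM0 fps_coef1 /= => gf.
by apply/unitrPr; exists (g 0%N); rewrite mulrC.
Qed.

Fact fps_invr_out : {in [predC fps_unit], fps_inv =1 id}.
Proof. by move=> f; rewrite inE /fps_inv unfold_in => /negbTE ->. Qed.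

HB.instance Definition _ := GRing.ComNzRing_hasMulInverse.Build (fps R)
  fps_mulVr fps_unitPl fps_invr_out.

(* The first n coefficients of the square root of f with constant term 1,
   obtained by solving s_0 s_m + s_1 s_(m-1) + ... + s_m s_0 = f_m for s_m. *)
Fixpoint fps_sqrt_prefix f (n : nat) : seq R :=
  if n is m.+1 then
    let s := fps_sqrt_prefix f m in
    rcons s (if m == 0%N then 1
             else (f m - \sum_(1 <= i < m) s`_i * s`_(m - i)) / 2%:R)
  else [::].

(* Only meaningful when f has constant term 1 and 2 is invertible. *)
Definition fps_sqrt f : fps R := Fps (fun n => (fps_sqrt_prefix f n.+1)`_n).

Lemma size_fps_sqrt_prefix f n : size (fps_sqrt_prefix f n) = n.
Proof. by elim: n => //= n IH; rewrite size_rcons IH. Qed.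

Lemma nth_fps_sqrt_prefix f n i :
  (i < n)%N -> (fps_sqrt_prefix f n)`_i = fps_sqrt f i.
Proof.
elim: n => // n IH; rewrite ltnS leq_eqVlt => /orP[/eqP ->//|ltin].
by rewrite /= nth_rcons size_fps_sqrt_prefix ltin IH.
Qed.

Lemma fps_sqrt0 f : fps_sqrt f 0%N = 1. Proof. by []. Qed.

Lemma fps_sqrtK f : (2%:R : R) \is a GRing.unit -> f 0%N = 1 ->
  fps_sqrt f ^+ 2 = f.
Proof.
move=> u2 f0; apply/fpsP => -[|n]; rewrite expr2.
  by rewrite fps_coefM0 fps_sqrt0 mulr1 f0.
have sE : fps_sqrt f n.+1 = (f n.+1
    - \sum_(i < n) fps_sqrt f i.+1 * fps_sqrt f (n - i)%N) / 2%:R.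
  rewrite {1}/fps_sqrt -[LHS]/((fps_sqrt_prefix f n.+2)`_n.+1).
  rewrite [fps_sqrt_prefix f n.+2]/= nth_rcons size_rcons size_fps_sqrt_prefix.
  rewrite ltnn eqxx; congr ((_ - _) / _); rewrite big_add1 big_mkord.
  apply: eq_bigr => i _; rewrite -[rcons _ _]/(fps_sqrt_prefix f n.+1).
  by rewrite !nth_fps_sqrt_prefix// ltnS ?subSS ?leq_subr// ltn_ord.
move: (fps_sqrt f) (fps_sqrt0 f) sE => s s0 sE.
rewrite fps_coefM big_ord_recl big_ord_recr /= /bump /= add1n subn0 subnn.
rewrite s0 mul1r mulr1.
rewrite addrCA -mulr2n -[s n.+1 *+ 2]mulr_natr sE divrK//.
rewrite (eq_bigr (fun i : 'I_n => s i.+1 * s (n - i)%N)) ?subrKC // => i _.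
Qed.

Lemma fps_sqrt_uniq f g : (2%:R : R) \is a GRing.unit ->
  f 0%N = 1 -> g 0%N = 1 -> f ^+ 2 = g ^+ 2 -> f = g.
Proof.
move=> u2 f0 g0 /eqP; rewrite -subr_eq0 subr_sqr => /eqP fg.
have fgu : f + g \is a GRing.unit.
  by rewrite -[_ \is a _]/((f + g) 0%N \is a GRing.unit) fps_coefD f0 g0.
by apply/eqP; rewrite -subr_eq0 -(mulrK fgu (f - g)) fg mul0r.
Qed.

End FpsUnit.

Record sgraph (T : finType) := SGraph {
  verts : {set T};
  adj : rel T;
  adj_sym : symmetric adj;
  adj_irr : irreflexive adj }.

Section Tubings.
Variables (T : finType) (G : sgraph T).
Implicit Types (s t : {set T}) (N : {set {set T}}).

(* The graph induced on t is connected (vacuously so for t empty). *)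
Definition connected_in t : bool :=
  [forall u in t, forall v in t,
    connect [rel a b | [&& a \in t, b \in t & adj G a b]] u v].

Definition compatible s t : bool :=
  [|| s \subset t, t \subset s |
      [disjoint s & t] && ~~ [exists u in s, exists v in t, adj G u v]].

Definition graph_tube t : bool :=
  [&& t != finset.set0, t \proper verts G & connected_in t].

Definition graph_tubing N : bool :=
  [forall s in N, graph_tube s]
  && [forall s in N, forall t in N, compatible s t].

End Tubings.

(* (true, i) stands for the positive element i + 1 of ±[n], and (false, i) for
   its opposite -(i + 1). *)
Definition signed (n : nat) : finType := (bool * 'I_n)%type.

Definition opp_signed n (v : signed n) : signed n := (~~ v.1, v.2).

Section HypercubeTubings.
Variables (n : nat) (G : sgraph (signed n)).
Implicit Types (t : {set signed n}) (N : {set {set signed n}}).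

Definition no_opposite t : bool := [forall v in t, opp_signed v \notin t].

Definition hc_tube t : bool :=
  [&& t != finset.set0, t \subset verts G, connected_in G t & no_opposite t].

Definition hc_tubing N : bool :=
  [&& [forall s in N, hc_tube s],
      [forall s in N, forall t in N, compatible G s t] &
      no_opposite (finset.cover N)].

End HypercubeTubings.

Definition path_adj n : rel 'I_n :=
  [rel i j : 'I_n | (i.+1 == j :> nat) || (j.+1 == i :> nat)].

(* For n = 1 there is no edge, and for n = 2 there is a single edge. *)
Definition cycle_adj n : rel 'I_n :=
  [rel i j : 'I_n | path_adj i j || (i != j) &&
    (((i == 0%N :> nat) && (j.+1 == n)) || ((j == 0%N :> nat) && (i.+1 == n)))].

Definition double_adj n (e : rel 'I_n) : rel (signed n) :=
  [rel u v : signed n | (u.1 == v.1) && e u.2 v.2].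

Lemma path_adj_sym n : symmetric (@path_adj n).
Proof. by move=> i j; rewrite /path_adj /= orbC. Qed.
Lemma path_adj_irr n : irreflexive (@path_adj n).
Proof. by move=> i; rewrite /path_adj /= orbb eqn_leq ltnn. Qed.
Lemma cycle_adj_sym n : symmetric (@cycle_adj n).
Proof.
by move=> i j; rewrite /cycle_adj /= path_adj_sym (eq_sym i) (orbC (_ && (j.+1 == n))).
Qed.
Lemma cycle_adj_irr n : irreflexive (@cycle_adj n).
Proof. by move=> i; rewrite /cycle_adj /= path_adj_irr eqxx. Qed.
Lemma double_adj_sym n e : symmetric e -> symmetric (@double_adj n e).
Proof. by move=> se u v; rewrite /double_adj /= eq_sym se. Qed.
Lemma double_adj_irr n e : irreflexive e -> irreflexive (@double_adj n e).
Proof. by move=> ie u; rewrite /double_adj /= ie andbF. Qed.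

Definition path_graph n : sgraph 'I_n :=
  SGraph finset.setT (@path_adj_sym n) (@path_adj_irr n).

Definition cycle_graph n : sgraph 'I_n :=
  SGraph finset.setT (@cycle_adj_sym n) (@cycle_adj_irr n).

Definition double_cycle n : sgraph (signed n) :=
  SGraph finset.setT (double_adj_sym (@cycle_adj_sym n))
    (double_adj_irr (@cycle_adj_irr n)).

(* The double path with the vertices -1 and -n, that is (false, 0) and
   (false, n - 1), removed. *)
Definition cis_double_path n : sgraph (signed n) :=
  SGraph [set v : signed n | v.1 || ((v.2 != 0%N :> nat) && (v.2.+1 != n))]
    (double_adj_sym (@path_adj_sym n)) (double_adj_irr (@path_adj_irr n)).

Section Polytopes.
Local Open Scope classical_set_scope.
Variable R : realType.

Definition dot d (u v : 'rV[R]_d) : R := \sum_(i < d) u 0 i * v 0 i.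

Definition conv_hull d m (v : 'I_m -> 'rV[R]_d) : set 'rV[R]_d :=
  [set x | exists a : 'I_m -> R, [/\ forall i, 0 <= a i, \sum_i a i = 1 &
                                     x = \sum_i a i *: v i]].

Record polytope := Polytope {
  ambient : nat;
  carrier : set 'rV[R]_ambient;
  polytopeP : exists (m : nat) (v : 'I_m.+1 -> 'rV[R]_ambient),
                carrier = conv_hull v }.
Arguments carrier : clear implicits.

(* The nonempty faces of P, P itself being the case u = 0. *)
Definition faces (P : polytope) : set (set 'rV[R]_(ambient P)) :=
  [set F | exists u : 'rV[R]_(ambient P),
     F = [set x | carrier P x /\
                  forall z, carrier P z -> dot u z <= dot u x]].
Arguments faces : clear implicits.

(* F has affine dimension k: the k + 1 points p, p + A_1, ..., p + A_k of F
   form an affine basis of its affine hull. *)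
Definition affine_dim d (F : set 'rV[R]_d) (k : nat) : Prop :=
  exists (p : 'rV[R]_d) (A : 'M[R]_(k, d)),
    [/\ F p, forall i, F (p + row i A), row_free A &
        forall x, F x -> (x - p <= A)%MS].

Definition nfaces (P : polytope) (k : nat) : nat :=
  #|` fset_set [set F | faces P F /\ affine_dim F k] |%fset.

(* P is the simple n-dimensional polytope dual to the simplicial complex of the
   sets satisfying K: reverse inclusion of its nonempty faces is isomorphic to
   inclusion of the simplices of the complex (P corresponding to the empty
   simplex), and simplices with k elements correspond to faces of dimension
   n - k. *)
Definition simple_dual_to (V : finType) (K : pred {set V}) (n : nat)
    (P : polytope) : Prop :=
  exists phi : {set V} -> set 'rV[R]_(ambient P),
    [/\ set_bij [set S | K S] (faces P) phi,
        forall S S', K S -> K S' -> (phi S' `<=` phi S <-> (S \subset S')%N) &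
        forall S, K S -> exists2 k : nat,
          (k + #|S|)%N = n & affine_dim (phi S) k].

Definition is_hypercube_graph_associahedron n (G : sgraph (signed n))
    (P : polytope) : Prop := simple_dual_to (hc_tubing G) n P.

Definition is_associahedron n (P : polytope) : Prop :=
  simple_dual_to (graph_tubing (path_graph n.+1)) n P.

Definition is_cyclohedron n (P : polytope) : Prop :=
  simple_dual_to (graph_tubing (cycle_graph n.+1)) n P.

End Polytopes.

Arguments carrier {R} P : rename.
Arguments faces {R} P : rename.

(* Power series in y over Q[x]. P n is meant to be n-dimensional, so that its
   faces have dimension at most n. *)
Definition fpoly (R : realType) (P : nat -> polytope R) : fps {poly rat} :=
  Fps (fun n => \sum_(k < n.+1) (nfaces (P n) k)%:R *: 'X^k).

(* A tubing of the cis double path on ±[n] has at most n tubes. *)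
Definition fpoly_cis : fps {poly rat} :=
  Fps (fun n => if n == 0%N then 1 else
    \sum_(k < n.+1)
      #|[set N | hc_tubing (cis_double_path n) N & #|N| == k]|%:R *: 'X^(n - k)).

Definition x_var : fps {poly rat} := fpsC 'X.

Definition at_x0 (f : fps {poly rat}) : fps rat :=
  fps_map (fun p => p.[0]) f.

(* Main.v *)
(* Tubings are the cliques of the compatibility relation on tubes.  Fix the two
   vertices of opposite signs at one position: a tubing either avoids both, or
   has a largest tube t meeting them, and then it is a tubing of t by proper
   tubes together with a tubing of the graph left after deleting t, its
   neighbours and its opposites.  For the double cycle, what is left is the
   double path on n - 1 positions if both vertices are avoided, nothing if t is
   one of the two cycles, and a cis double path if t is one of the 2 m arcs of m
   vertices through the chosen position.  Hence, with u = y f^A,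
     f^DC = 1 + x y f^D + 2 y f^B + 2 y u' (f^C - 1),
   where f^D belongs to the double path.  The same recursion applied to paths,
   cycles and double paths expresses f^B and f^D as the same rational function
   of x and u, where u = y (1 + u) (1 + (1 + x) u). *)

Require Import Defs.
From mathcomp Require Import all_boot all_order all_algebra finmap.
From mathcomp Require Import zify ring.

Set Implicit Arguments.
Unset Strict Implicit.
Unset Printing Implicit Defensive.

Import GRing.Theory.
Local Open Scope ring_scope.

(** * Clique polynomials *)

(** That a union of tubes contains no pair {i,-i} is a global condition. Counting opposite vertices
    as adjacent when two tubes are compared makes it pairwise, so that tubings are cliques. The two
    vertices at one position then keep any two tubes that meet them from being separated, so
    compatible ones are nested, which is why a largest one exists. Cutting a tube of sign e out of a
    double path leaves a shorter one that lacks sign e at the cut. The recursion therefore leaves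
    the class of double paths; it closes on strips, whose signs are restricted separately
    everywhere, at the first position and at the last. Tubings are first counted by polynomials in
    the number of tubes, for which mutually compatible families multiply, and only then homogenized
    by the dimension: in the recursion the largest tube then contributes 1 and an avoided position
    contributes x. *)

Section CliquePolynomial.
Variables (V : finType) (c : rel V).
Implicit Types F N S : {set V}.

Definition cliques F : {set {set V}} :=
  [set N : {set V} | (N \subset F) && [forall s in N, forall t in N, c s t]].

Definition clique_poly F : {poly rat} := \sum_(N in cliques F) 'X^#|N|.

Lemma cliquesP F N :
  reflect (N \subset F /\ {in N &, forall s t, c s t}) (N \in cliques F).
Proof.
rewrite inE; apply: (iffP andP) => -[NF H]; split=> //.
  by move=> s t sN tN; move/forall_inP/(_ s sN)/forall_inP: H; apply.
by apply/forall_inP => s sN; apply/forall_inP => t; apply: H.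
Qed.

Lemma coef_clique_poly F k :
  (clique_poly F)`_k = #|[set N in cliques F | #|N| == k]|%:R.
Proof.
rewrite coef_sum -sum1_card natr_sum [RHS]big_mkcond [LHS]big_mkcond.
apply: eq_bigr => N _; rewrite [in RHS]inE coefXn eq_sym.
by case: (N \in _) => //=; case: eqP.
Qed.

Lemma clique_poly0 : clique_poly set0 = 1.
Proof.
rewrite /clique_poly (_ : cliques set0 = [set set0]).
  by rewrite big_set1 cards0 expr0.
apply/setP => N; rewrite [RHS]inE; apply/cliquesP/eqP => [[]|->].
  by rewrite subset0 => /eqP.
by split=> // s t; rewrite inE.
Qed.

Lemma clique_polyU F1 F2 : [disjoint F1 & F2] ->
    {in F1 & F2, forall s t, c s t && c t s} ->
  clique_poly (F1 :|: F2) = clique_poly F1 * clique_poly F2.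
Proof.
move=> d12 c12; rewrite /clique_poly big_distrlr /= pair_big /=.
have dis N1 N2 : N1 \subset F1 -> N2 \subset F2 -> N1 :&: N2 = set0.
  move=> s1 s2; apply/eqP; rewrite setI_eq0.
  by apply: disjointWl s1 (disjointWr s2 d12).
rewrite (reindex_onto (fun p : {set V} * {set V} => p.1 :|: p.2)
  (fun N => (N :&: F1, N :&: F2))) /=; last first.
  by move=> N /cliquesP[NF _]; rewrite -setIUr; apply/setIidPl.
apply: eq_big => [[N1 N2]|[N1 N2]] /=; last first.
  case/andP => _ /eqP[e1 e2].
  by rewrite cardsU (dis N1 N2) ?cards0 ?subn0 ?exprD // -1?e1 -1?e2 subsetIr.
apply/andP/andP => [[/cliquesP[sU cU] /eqP[e1 e2]]|[/cliquesP[s1 c1] /cliquesP[s2 c2]]].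
  have [i1 i2] : N1 \subset F1 /\ N2 \subset F2 by rewrite -e1 -e2 !subsetIr.
  by split; apply/cliquesP; split=> // s t sN tN; apply: cU; rewrite inE ?sN ?tN ?orbT.
split.
  apply/cliquesP; split; first exact: setUSS.
  move=> s t /setUP[sN|sN] /setUP[tN|tN]; [exact: c1| | |exact: c2].
    by have /andP[] := c12 _ _ (subsetP s1 _ sN) (subsetP s2 _ tN).
  by have /andP[] := c12 _ _ (subsetP s1 _ tN) (subsetP s2 _ sN).
apply/eqP; congr (_, _); rewrite setIUl.
  rewrite (setIidPl s1) (_ : N2 :&: F1 = set0) ?setU0 //.
  by rewrite setIC; apply: dis.
by rewrite (setIidPl s2) (_ : N1 :&: F2 = set0) ?set0U //; apply: dis.
Qed.

Hypotheses (c_refl : reflexive c) (c_sym : symmetric c).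

(* A clique meeting S contains exactly one element of S of maximal size; the
   sum is over that element. *)
Lemma clique_poly_rec F S (mu : V -> nat) : S \subset F ->
    {in S &, forall s t, s != t -> c s t -> mu s != mu t} ->
  clique_poly F = clique_poly (F :\: S) + 'X * \sum_(t in S)
    clique_poly [set s in F | [&& s != t, c s t & (s \in S) ==> (mu s < mu t)%N]].
Proof.
move=> SF muS; pose top N t :=
  [&& t \in N, t \in S & [forall s in N, (s \in S) ==> (s != t) ==> (mu s < mu t)%N]].
have topP N t s : top N t -> s \in N -> s \in S -> s != t -> (mu s < mu t)%N.
  by case/and3P=> _ _ /forall_inP H /H /implyP H' /H' /implyP.
rewrite /clique_poly (bigID (fun N => N :&: S == set0)) /=; congr (_ + _).
  apply: eq_bigl => N; apply/andP/cliquesP => [[/cliquesP[NF cN] NS]|[NF cN]].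
    by split=> //; rewrite subsetD NF -setI_eq0.
  by move: NF; rewrite subsetD -setI_eq0 => /andP[? ->]; split=> //; apply/cliquesP.
rewrite big_distrr /=.
(* The inner sum has exactly one term when [N] meets [S], since [mu] separates the members of [S] in
   a clique, and none otherwise. *)
transitivity (\sum_(N in cliques F) \sum_(t in S | top N t) 'X^#|N| : {poly rat}).
  rewrite big_mkcondr /=; apply: eq_bigr => N /cliquesP[NF cN].
  case: ifPn => [/set0Pn[s0 s0NS]|].
    case: (@arg_maxnP _ s0 (fun s => s \in N :&: S) mu) => [|t /setIP[tN tS] tmax] //.
    rewrite (big_pred1 t) // => s /=; apply/andP/eqP => [[sS top_s]|->].
      apply/eqP/negPn/negP => st.
      have := tmax s; rewrite inE sS andbT => /(_ (proj1 (andP top_s))).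
      by rewrite /= leqNgt (topP _ _ _ top_s) // eq_sym.
    split=> //; rewrite /top tN tS; apply/forall_inP => r rN.
    apply/implyP => rS; apply/implyP => rt; rewrite ltn_neqAle.
    by rewrite muS ?cN //=; apply: tmax; rewrite inE rN.
  rewrite negbK => /eqP NS; rewrite big_pred0 // => t.
  apply/negP => /andP[tS /and3P[tN _ _]].
  by have := in_set0 t; rewrite -NS inE tN tS.
rewrite (exchange_big_dep (mem S)) /= => [|N t _ /andP[]//].
apply: eq_bigr => t tS; rewrite big_distrr /=.
rewrite (reindex_onto (fun N => t |: N) (fun N => N :\ t)) /=; last first.
  by move=> N /andP[_ /andP[_ /and3P[tN _ _]]]; rewrite setD1K.
apply: eq_big => N; last first.
  case/andP => _ /eqP e; rewrite cardsU1 -{1}e setD11 /=.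
  by rewrite exprD expr1.
apply/idP/cliquesP => [/andP[/andP[/cliquesP[NF cN] /andP[_ tp]] /eqP e]|[NF cN]].
  have tN : t \notin N by rewrite -e setD11.
  split=> [|s r sN rN]; last by apply: cN; rewrite inE ?sN ?rN orbT.
  apply/subsetP => s sN; have st : s != t by apply: contraNneq tN => <-.
  have sN' : s \in t |: N by rewrite inE sN orbT.
  rewrite inE (subsetP NF) // st cN ?inE ?eqxx //=; last by rewrite sN orbT.
  by apply/implyP => sS; apply: topP tp _ _ _.
have tN : t \notin N.
  by apply/negP => /(subsetP NF); rewrite inE eqxx /= andbF.
rewrite setU1K // eqxx andbT; apply/andP; split.
  apply/cliquesP; split.
    apply/subsetP => s /setU1P[->|/(subsetP NF)]; first exact: (subsetP SF).
    by rewrite inE => /andP[].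
  move=> s r /setU1P[->|sN] /setU1P[->|rN]; rewrite ?c_refl //; last exact: cN.
    by have := subsetP NF _ rN; rewrite inE c_sym => /and4P[].
  by have := subsetP NF _ sN; rewrite inE => /and4P[].
rewrite tS /top setU11 tS /=; apply/forall_inP => s /setU1P[->|sN].
  by rewrite eqxx implybT.
have := subsetP NF _ sN; rewrite inE => /and4P[_ _ _ /implyP H].
by apply/implyP => /H ->; rewrite implybT.
Qed.

End CliquePolynomial.

Lemma clique_poly_imset (V V' : finType) (c : rel V) (c' : rel V') (f : V -> V')
    (F : {set V}) :
    {in F &, injective f} -> {in F &, forall s t, c' (f s) (f t) = c s t} ->
  clique_poly c' (f @: F) = clique_poly c F.
Proof.
move=> f_inj fc; rewrite /clique_poly.
have -> : cliques c' (f @: F) = [set f @: (N : {set V}) | N in cliques c F].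
  apply/setP => N; apply/cliquesP/imsetP => [[NF cN]|[M /cliquesP[MF cM] ->]].
    have NE : N = f @: [set s in F | f s \in N].
      apply/setP => t; apply/idP/imsetP => [tN|[s /[!inE] /andP[_ ?] ->] //].
      by have /imsetP[s sF tE] := subsetP NF t tN; exists s; rewrite // inE sF -tE.
    exists [set s in F | f s \in N] => //; apply/cliquesP; split.
      by apply/subsetP => s; rewrite inE => /andP[].
    by move=> s t /[!inE] /andP[sF sN] /andP[tF tN]; rewrite -fc ?cN.
  split; first exact: imsetS.
  move=> _ _ /imsetP[s sM ->] /imsetP[t tM ->].
  by rewrite fc ?cM // (subsetP MF).
rewrite big_imset /=.
  apply: eq_bigr => N /cliquesP[/subsetP NF _].
  by rewrite card_in_imset // => s t /NF sF /NF tF; apply: f_inj.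
suff sub (A B : {set V}) : A \subset F -> B \subset F -> f @: A = f @: B -> A \subset B.
  move=> A B /cliquesP[AF _] /cliquesP[BF _] e.
  by apply/eqP; rewrite eqEsubset; apply/andP; split; apply: sub.
move=> AF BF e; apply/subsetP => s sA.
have : f s \in f @: B by rewrite -e imset_f.
case/imsetP => t tB fst; rewrite (f_inj s t) //; first exact: (subsetP AF).
exact: (subsetP BF).
Qed.

(** * Tubes *)

(** A set closed under adjacency inside [t] contains all that is reachable from its points;
    conversely the set reachable from [u] is closed. In this form a tube is identified by exhibiting
    a closed subset of it. *)
Lemma connected_inP (T : finType) (G : sgraph T) (t : {set T}) :
  reflect (forall A : {set T}, A \subset t -> A != set0 ->
             {in A & t, forall u v, adj G u v -> v \in A} -> A = t)
          (connected_in G t).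
Proof.
apply: (iffP idP) => [/forall_inP conn A At /set0Pn[u uA] Acl|H].
  apply/eqP; rewrite eqEsubset At; apply/subsetP => v vt.
  have /forall_inP/(_ v vt)/connectP[p] := conn u (subsetP At u uA).
  elim: p u uA => [|w p IHp] u uA /=; first by move=> _ ->.
  by case/andP => /and3P[_ wt uw]; apply: IHp; apply: Acl uw.
apply/forall_inP => u ut; apply/forall_inP => v vt.
pose e := [rel a b | [&& a \in t, b \in t & adj G a b]].
rewrite -/e; suff AE : [set w in t | connect e u w] = t.
  by move: vt; rewrite -{1}AE inE => /andP[].
apply: H => [||a b].
- by apply/subsetP => w; rewrite inE => /andP[].
- by apply/set0Pn; exists u; rewrite inE ut connect0.
rewrite !inE => /andP[ta ua] tb ab; rewrite tb (connect_trans ua) //.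
by apply: connect1; rewrite /= ta tb.
Qed.

Lemma connected_in_imset (T T' : finType) (G : sgraph T) (G' : sgraph T')
    (f : T -> T') (t : {set T}) :
    {in t &, injective f} -> {in t &, forall u v, adj G' (f u) (f v) = adj G u v} ->
  connected_in G' (f @: t) = connected_in G t.
Proof.
move=> f_inj fG; apply/connected_inP/connected_inP => conn A At A0 Acl.
  apply/eqP; rewrite eqEsubset At; apply/subsetP => v vt.
  have : f v \in f @: A.
    rewrite (conn (f @: A)) ?imset_f ?imsetS //.
      by have /set0Pn[u uA] := A0; apply/set0Pn; exists (f u); rewrite imset_f.
    move=> _ _ /imsetP[a aA ->] /imsetP[b bt ->].
    by rewrite (fG _ _ (subsetP At a aA) bt) => /(Acl _ _ aA bt)/(imset_f f).
  by case/imsetP => u uA /f_inj -> //; apply: (subsetP At).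
pose B := [set u in t | f u \in A].
have AE : A = f @: B.
  apply/setP => y; apply/idP/imsetP => [yA|[u /[!inE] /andP[_ ?] ->] //].
  by have /imsetP[u ut yE] := subsetP At y yA; exists u; rewrite // inE ut -yE.
rewrite AE (conn B) //.
- by apply/subsetP => u; rewrite inE => /andP[].
- by apply: contraNneq A0 => B0; rewrite AE B0 imset0.
move=> u v /[!inE] /andP[ut uA] vt uv.
by rewrite vt (Acl (f u)) ?imset_f ?fG.
Qed.

Section Tubes.
Variables (T : finType) (G : sgraph T) (o : rel T).
Implicit Types (s t X Y Q : {set T}).

Definition separated s t :=
  [disjoint s & t] && [forall u in s, forall v in t, ~~ (adj G u v || o u v)].

Definition tube_compat s t := [|| s \subset t, t \subset s | separated s t].

Definition tubes X : {set {set T}} :=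
  [set t : {set T} | [&& t != set0, t \subset X, connected_in G t &
                         [forall u in t, forall v in t, ~~ o u v]]].

Definition tubing_poly X := clique_poly tube_compat (tubes X).
(** The convention of associahedra and cyclohedra, where the whole vertex set is not a tube. *)
Definition ptubing_poly X := clique_poly tube_compat (tubes X :\ X).

Definition nbhd t :=
  [set v | (v \in t) || [exists u in t, adj G u v || o u v]].

Lemma separatedP s t :
  reflect (forall u v, u \in s -> v \in t -> [/\ u <> v, ~~ adj G u v & ~~ o u v])
          (separated s t).
Proof.
apply: (iffP andP) => [[d /forall_inP H] u v us vt|H].
  have /forall_inP/(_ v vt) := H u us; rewrite negb_or => /andP[-> ->]; split=> // uv.
  by have := disjoint_setI0 d => /setP/(_ u); rewrite !inE us uv vt.
split.
  rewrite -setI_eq0; apply/eqP/setP => u; rewrite !inE.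
  by apply/negP => /andP[us ut]; have [] := H u u us ut.
apply/forall_inP => u us; apply/forall_inP => v vt.
by have [_ ? ?] := H u v us vt; apply/norP.
Qed.

Lemma tubesP X t :
  reflect [/\ t != set0, t \subset X, connected_in G t & {in t &, forall u v, ~~ o u v}]
          (t \in tubes X).
Proof.
rewrite inE; apply: (iffP and4P) => -[-> -> -> H]; split=> //.
  by move=> u v ut vt; move/forall_inP/(_ u ut)/forall_inP: H; apply.
by apply/forall_inP => u ut; apply/forall_inP => v; apply: H.
Qed.

Lemma tubes_sub X Y t : t \in tubes X -> t \subset Y -> t \in tubes Y.
Proof. by case/tubesP => ? _ ? ? ?; apply/tubesP. Qed.

Lemma sub_setD_nbhd X s t : (s \subset X :\: nbhd t) = (s \subset X) && separated t s.
Proof.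
apply/subsetP/andP => [H|[/subsetP sX /separatedP ts] v vs].
  split; first by apply/subsetP => v /H /setDP[].
  apply/separatedP => u v ut /H /setDP[_]; rewrite inE negb_or => /andP[vt].
  rewrite negb_exists => /forallP/(_ u); rewrite ut negb_or => /andP[-> ->].
  by split=> // uv; rewrite -uv ut in vt.
rewrite inE sX // andbT inE; apply/norP; split; first by apply/negP => /ts/(_ vs)[].
by apply/negP => /exists_inP[u /ts/(_ vs)[_ /negPf-> /negPf->]].
Qed.

Hypothesis o_sym : symmetric o.

Lemma separated_sym : symmetric separated.
Proof.
have sub s t : separated s t -> separated t s.
  move/separatedP => H; apply/separatedP => u v ut vs.
  by have [nvu] := H v u vs ut; rewrite adj_sym o_sym; split=> // uv; apply: nvu.
by move=> s t; apply/idP/idP; apply: sub.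
Qed.

Lemma tube_compat_refl : reflexive tube_compat.
Proof. by move=> t; rewrite /tube_compat subxx. Qed.

Lemma tube_compat_sym : symmetric tube_compat.
Proof. by move=> s t; rewrite /tube_compat separated_sym orbCA. Qed.

(** [X] is compatible with every tube inside it, so it can be added to any tubing by proper tubes or
    left out. *)
Lemma tubing_poly_tube X : X \in tubes X -> tubing_poly X = (1 + 'X) * ptubing_poly X.
Proof.
move=> tX; rewrite /tubing_poly.
rewrite (@clique_poly_rec _ _ tube_compat_refl tube_compat_sym _ [set X] (fun=> 0%N)).
- rewrite big_set1 mulrDl mul1r; congr (_ + _ * clique_poly _ _).
  apply/setP => s; rewrite in_setD1 [LHS]inE /tube_compat in_set1 [RHS]andbC.
  case: (boolP (s \in _)) => //= /tubesP[_ -> _ _].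
  by case: eqP.
- by rewrite sub1set.
- by move=> s t /set1P-> /set1P->; rewrite eqxx.
Qed.

(* Two compatible tubes meeting Q are nested, so a tubing that does not avoid Q
   has a largest tube t meeting Q; its other tubes lie in t or outside nbhd t. *)
Lemma tubing_poly_rec X Q :
    {in Q &, forall u v, u != v -> adj G u v || o u v} ->
  tubing_poly X = tubing_poly (X :\: Q)
    + 'X * \sum_(t in tubes X | ~~ [disjoint t & Q])
             ptubing_poly t * tubing_poly (X :\: nbhd t).
Proof.
move=> Qadj; pose S := [set t in tubes X | ~~ [disjoint t & Q]].
have nsepS s t : s \in S -> t \in S -> ~~ separated s t.
  rewrite !inE => /andP[_ /pred0Pn[u /andP[/= us uQ]]].
  move=> /andP[_ /pred0Pn[v /andP[/= vt vQ]]]; apply/negP => /separatedP/(_ u v us vt).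
  by case=> /eqP uv nuv nouv; have := Qadj u v uQ vQ uv; rewrite (negPf nuv) (negPf nouv).
rewrite [LHS]/tubing_poly.
rewrite (@clique_poly_rec _ _ tube_compat_refl tube_compat_sym _ S (fun t => #|t|)).
- congr (_ + _ * _).
    congr clique_poly; apply/setP => t; rewrite !inE subsetD.
    by case: [disjoint t & Q]; rewrite ?andbT ?andbF //= ?andNb // andbC; case: (_ && _).
  rewrite (eq_bigl (fun t => (t \in tubes X) && ~~ [disjoint t & Q])); last first.
    by move=> t; rewrite !inE.
  apply: eq_bigr => t /andP[tX tQ].
  have tS : t \in S by rewrite inE tX.
  have tsX : t \subset X by have /tubesP[] := tX.
  rewrite -clique_polyU; first congr clique_poly.
  + apply/setP => s; rewrite [LHS]inE [RHS]inE in_setD1.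
    apply/idP/idP => [/and4P[sX st]|/orP[/andP[st /tubesP[s0 sst sc so]]|sF]].
    * case/or3P => [sst _|ts|sep _].
      - by rewrite st (tubes_sub sX).
      (* A tube containing [t] also meets [Q], so the maximality of [t] excludes it. *)
      - have sS : s \in S.
          rewrite inE sX; have /pred0Pn[u /andP[/= ut uQ]] := tQ.
          by apply/pred0Pn; exists u; rewrite /= (subsetP ts).
        rewrite sS /= => /ltn_geF.
        by rewrite (subset_leq_card ts).
      - apply/orP; right; apply: (tubes_sub sX); rewrite sub_setD_nbhd separated_sym sep andbT.
        by have /tubesP[] := sX.
    * have sX : s \in tubes X by apply/tubesP; split=> //; apply: subset_trans tsX.
      rewrite sX st /tube_compat sst /= proper_card ?implybT //.
      by rewrite properEneq st.
    have /tubesP[s0 + sc so] := sF; rewrite sub_setD_nbhd => /andP[sX sep].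
    rewrite separated_sym in sep.
    have -> /= : s \in tubes X by apply/tubesP.
    rewrite /tube_compat sep !orbT /=; apply/andP; split.
      apply: contraTneq sep => ->; exact: nsepS.
    by apply/implyP => sS; case/negP: (nsepS _ _ sS tS).
  + rewrite -setI_eq0; apply/eqP/setP => s; rewrite !inE.
    apply/negP => /andP[/andP[_ /and4P[/set0Pn[u us] st _ _]]].
    rewrite sub_setD_nbhd => /and3P[_ /andP[_ /separatedP ts] _].
    by have [] := ts u u (subsetP st u us) us.
  + move=> s r /setD1P[_ /tubesP[_ st _ _]] /tubesP[_ + _ _].
    rewrite sub_setD_nbhd => /andP[_ /separatedP tr].
    suff sr : separated s r by rewrite /tube_compat separated_sym [separated r s]separated_sym sr !orbT.
    by apply/separatedP => u v us; apply: tr; apply: (subsetP st).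
- by apply/subsetP => t; rewrite inE => /andP[].
move=> s t sS tS st; rewrite /tube_compat (negPf (nsepS _ _ sS tS)) orbF.
case/orP => sub; [|rewrite eq_sym].
  by rewrite neq_ltn proper_card // properEneq st.
by rewrite neq_ltn proper_card // properEneq eq_sym st.
Qed.

End Tubes.

(** * Invariance of tubing polynomials under induced embeddings *)

Section TubeEmbedding.
Variables (T T' : finType) (G : sgraph T) (G' : sgraph T') (o : rel T) (o' : rel T').
Variables (f : T -> T') (X : {set T}).
Hypotheses (f_inj : {in X &, injective f})
  (fG : {in X &, forall u v, adj G' (f u) (f v) = adj G u v})
  (fo : {in X &, forall u v, o' (f u) (f v) = o u v}).

Lemma tubes_imset : tubes G' o' (f @: X) = [set f @: (t : {set T}) | t in tubes G o X].
Proof.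
have conn (t : {set T}) : t \subset X -> connected_in G' (f @: t) = connected_in G t.
  move/subsetP => tX; apply: connected_in_imset => u v ut vt; first by apply: f_inj; apply: tX.
  by apply: fG; apply: tX.
apply/setP => s; apply/tubesP/imsetP => [[s0 sX sc so]|[t /tubesP[t0 tX tc to] ->]].
  pose t := [set u in X | f u \in s].
  have tX : t \subset X by apply/subsetP => u; rewrite inE => /andP[].
  have sE : s = f @: t.
    apply/setP => y; apply/idP/imsetP => [ys|[u /[!inE] /andP[_ ?] ->] //].
    by have /imsetP[u uX yE] := subsetP sX y ys; exists u; rewrite // inE uX -yE.
  exists t => //; apply/tubesP; split=> //.
  - by apply: contraNneq s0 => t0; rewrite sE t0 imset0.
  - by rewrite -conn // -sE.
  - by move=> u v /[!inE] /andP[uX us] /andP[vX vs]; rewrite -fo ?so.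
split; rewrite ?imsetS ?conn //.
  by have /set0Pn[u ut] := t0; apply/set0Pn; exists (f u); rewrite imset_f.
move=> _ _ /imsetP[u ut ->] /imsetP[v vt ->].
by rewrite fo ?(subsetP tX) // to.
Qed.

Let imset_subset (s t : {set T}) : s \subset X -> t \subset X ->
  (f @: s \subset f @: t) = (s \subset t).
Proof.
move=> /subsetP sX /subsetP tX; apply/idP/idP => [/subsetP H|]; last exact: imsetS.
apply/subsetP => u us; have /imsetP[v vt] := H _ (imset_f f us).
by move/f_inj => -> //; [apply: sX | apply: tX].
Qed.

Let imset_injX : {in [pred s : {set T} | s \subset X] &, injective (fun s : {set T} => f @: s)}.
Proof.
move=> s t /= sX tX e; apply/eqP.
by rewrite eqEsubset -(imset_subset sX tX) -(imset_subset tX sX) e subxx.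
Qed.

Lemma tube_compat_imset (s t : {set T}) : s \subset X -> t \subset X ->
  tube_compat G' o' (f @: s) (f @: t) = tube_compat G o s t.
Proof.
move=> sX tX; rewrite /tube_compat !imset_subset //; congr [|| _, _ | _].
apply/separatedP/separatedP => H u v.
  move=> us vt; have uX := subsetP sX u us; have vX := subsetP tX v vt.
  by have [fuv] := H _ _ (imset_f f us) (imset_f f vt); rewrite fG ?fo //; split=> // uv; rewrite uv in fuv.
case/imsetP => a as_ -> /imsetP[b bt ->].
have aX := subsetP sX a as_; have bX := subsetP tX b bt.
by have [ab] := H _ _ as_ bt; rewrite fG ?fo //; split=> // /f_inj ?; apply: ab; auto.
Qed.

Lemma tubing_poly_imset : tubing_poly G' o' (f @: X) = tubing_poly G o X.
Proof.
rewrite /tubing_poly tubes_imset; apply: clique_poly_imset => s t /tubesP[_ sX _ _] /tubesP[_ tX _ _].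
  exact: imset_injX.
exact: tube_compat_imset.
Qed.

Lemma ptubing_poly_imset : ptubing_poly G' o' (f @: X) = ptubing_poly G o X.
Proof.
rewrite /ptubing_poly tubes_imset.
have -> : [set f @: (t : {set T}) | t in tubes G o X] :\ f @: X
        = [set f @: (t : {set T}) | t in tubes G o X :\ X].
  apply/setP => s; apply/setD1P/imsetP => [[sX /imsetP[t tX sE]]|[t /setD1P[tX tt] ->]].
    by exists t; rewrite // in_setD1 tX andbT; apply: contraNneq sX => <-; rewrite sE.
  split; last exact: imset_f.
  apply: contraNneq tX => /imset_injX -> //; rewrite inE ?subxx //.
  by have /tubesP[] := tt.
apply: clique_poly_imset => s t /setD1P[_ /tubesP[_ sX _ _]] /setD1P[_ /tubesP[_ tX _ _]].
  exact: imset_injX.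
exact: tube_compat_imset.
Qed.

End TubeEmbedding.

(** * Double paths and double cycles *)

Section ArcMaps.
Variables (n m a : nat).

Definition arc_pos (i : 'I_m) : 'I_n.+1 := inZp (a + i).
Definition arc_map (v : signed m) : signed n.+1 := (v.1, arc_pos v.2).
Definition sign_arc (e : bool) (i : 'I_m) : signed n.+1 := (e, arc_pos i).

Hypotheses (a_le : (a <= n.+1)%N) (m_le : (m <= n.+1)%N).

(** The residue is described by linear equations, so that all later position arguments are left to
    [lia]. *)
Lemma arc_posE i : (arc_pos i < n.+1)%N /\
  (arc_pos i = a + i :> nat \/ arc_pos i + n.+1 = a + i)%N.
Proof.
split=> //; have lt_im := ltn_ord i; have [?|?] := ltnP (a + i) n.+1.
  by left; rewrite /= modn_small.
by right; rewrite /= -{1}(@subnK n.+1 (a + i)) // modnDr modn_small; lia.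
Qed.

Lemma arc_pos_inj : injective arc_pos.
Proof.
move=> i j /(congr1 (@nat_of_ord _)) ij; apply: ord_inj.
have := arc_posE i; have := arc_posE j; have := ltn_ord i; have := ltn_ord j; lia.
Qed.

Lemma arc_map_inj : injective arc_map.
Proof.
by case=> [e i] [e' j] /eqP; rewrite xpair_eqE => /andP[/eqP /= -> /eqP /arc_pos_inj ->].
Qed.

Lemma sign_arc_inj e : injective (sign_arc e).
Proof. by move=> i j /(congr1 snd) /arc_pos_inj. Qed.

Lemma opp_arc_map u v :
  (arc_map v == opp_signed (arc_map u)) = (v == opp_signed u).
Proof.
by rewrite -(inj_eq arc_map_inj).
Qed.

Lemma path_adj_arc i j : (a + m <= n.+1)%N ->
  path_adj (arc_pos i) (arc_pos j) = path_adj i j.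
Proof.
move=> am; move: (arc_pos i) (arc_pos j) (arc_posE i) (arc_posE j) => p q.
rewrite /path_adj /=; have := ltn_ord i; have := ltn_ord j; lia.
Qed.

(** An arc that misses a position has ends that are not joined around the cycle, so it induces a
    path. *)
Lemma cycle_adj_arc i j : (m <= n)%N ->
  cycle_adj (arc_pos i) (arc_pos j) = path_adj i j.
Proof.
move=> mn; move: (arc_pos i) (arc_pos j) (arc_posE i) (arc_posE j) => p q.
rewrite /cycle_adj /path_adj /= -val_eqE /=; have := ltn_ord i; have := ltn_ord j; lia.
Qed.

Lemma mem_arc_map (P : bool -> nat -> bool) (y : signed n.+1) : (a + m <= n.+1)%N ->
  (y \in arc_map @: [set v : signed m | P v.1 v.2])
  = [&& (a <= y.2)%N, (y.2 < a + m)%N & P y.1 (y.2 - a)%N].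
Proof.
move=> am; apply/imsetP/and3P => [[v /[!inE] Pv ->]|[ay ym Py]].
  have := arc_posE v.2; have := ltn_ord v.2 => ? ?.
  rewrite -[(arc_map v).2]/(arc_pos v.2) -[(arc_map v).1]/(v.1).
  have -> : arc_pos v.2 = (a + v.2)%N :> nat by lia.
  by rewrite addKn; split=> //; lia.
have ym' : (y.2 - a < m)%N by lia.
exists (y.1, Ordinal ym'); first by rewrite inE.
case: y ay ym ym' {Py} => e i /= ay ym ym'; congr (_, _); apply: ord_inj.
rewrite -[X in arc_pos X]/(Ordinal ym'); have := arc_posE (Ordinal ym'); rewrite -[nat_of_ord (Ordinal ym')]/(i - a)%N; have := ltn_ord i; lia.
Qed.

End ArcMaps.

Definition opposite n : rel (signed n) := fun u v => v == opp_signed u.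
Arguments opposite : clear implicits.

Lemma opp_signedK n : involutive (@opp_signed n).
Proof. by case=> e i; rewrite /opp_signed /= negbK. Qed.

Lemma opposite_sym n : symmetric (opposite n).
Proof. by move=> u v; rewrite /opposite -(inj_eq (inv_inj (@opp_signedK n))) opp_signedK eq_sym. Qed.

Definition no_opposition (T : Type) : rel T := fun _ _ => false.
Arguments no_opposition : clear implicits.

(* Off by one: path_poly n and cycle_poly n concern the polytopes of dimension
   n - 1. *)
Definition path_poly n := ptubing_poly (path_graph n) (no_opposition _) setT.
Definition cycle_poly n := ptubing_poly (cycle_graph n) (no_opposition _) setT.

Lemma no_opposite_sign n (e : bool) (u v : signed n) :
  u.1 == e -> v.1 == e -> ~~ opposite n u v.
Proof. by move=> /eqP ue /eqP ve; apply/eqP => /(congr1 fst) /=; rewrite ue ve; case: e {ue ve}. Qed.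

Lemma connected_path n : connected_in (path_graph n) setT.
Proof.
apply/connected_inP => A _ /set0Pn[u uA] Acl; apply/setP => v; rewrite inE.
have step d (w : 'I_n) : (w = u + d :> nat \/ u = w + d :> nat)%N -> w \in A.
  elim: d w => [|d IHd] w /= wu.
    by rewrite (_ : w = u) //; apply: val_inj => /=; lia.
  have lt_un := ltn_ord u; have lt_wn := ltn_ord w.
  case: wu => wu.
    have lt : (u + d < n)%N by lia.
    apply: (Acl (Ordinal lt)) => //; first by apply: IHd => /=; lia.
    by rewrite /= /path_adj /=; lia.
  have lt : (w.+1 < n)%N by lia.
  apply: (Acl (Ordinal lt)) => //; first by apply: IHd => /=; lia.
  by rewrite /= /path_adj /=; lia.
by case: (leqP u v) => uv; [apply: (step (v - u)%N) | apply: (step (u - v)%N)]; lia.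
Qed.

Definition double_path n : sgraph (signed n) :=
  SGraph setT (double_adj_sym (@path_adj_sym n)) (double_adj_irr (@path_adj_irr n)).

(* Signs are restricted to L at the first position and to R at the last one;
   M restricts them everywhere. *)
Definition strip n (M L R : pred bool) : {set signed n} :=
  [set v : signed n | [&& M v.1, (v.2 == 0 :> nat)%N ==> L v.1 &
                          (v.2.+1 == n) ==> R v.1]].

Definition strip_poly n M L R :=
  tubing_poly (double_path n) (opposite n) (strip n M L R).

Lemma tubing_poly_set0 (T : finType) (G : sgraph T) o : tubing_poly G o set0 = 1.
Proof.
rewrite /tubing_poly (_ : tubes _ _ _ = set0) ?clique_poly0 //.
apply/setP => t; rewrite in_set0; apply/negbTE/negP => /tubesP[+ + _ _].
by rewrite subset0 => /negPf->.
Qed.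

Lemma strip_poly0 M L R : strip_poly 0 M L R = 1.
Proof.
rewrite /strip_poly (_ : strip _ _ _ _ = set0) ?tubing_poly_set0 //.
by apply/setP => -[? []].
Qed.

Lemma strip_poly_shift n k a M L R : (a + k <= n.+1)%N ->
  tubing_poly (double_path n.+1) (opposite _) (arc_map n a @: strip k M L R)
  = strip_poly k M L R.
Proof.
move=> ak; apply: tubing_poly_imset => u v _ _.
- by apply: arc_map_inj; lia.
- by rewrite /= /double_adj /= path_adj_arc //; lia.
- by rewrite /opposite opp_arc_map //; lia.
Qed.

Lemma strip_poly_shift_cycle n k a M L R : (a <= n.+1)%N -> (k <= n)%N ->
  tubing_poly (double_cycle n.+1) (opposite _) (arc_map n a @: strip k M L R)
  = strip_poly k M L R.
Proof.
move=> an kn; apply: tubing_poly_imset => u v _ _.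
- by apply: arc_map_inj; lia.
- by rewrite /= /double_adj /= cycle_adj_arc //; lia.
- by rewrite /opposite opp_arc_map //; lia.
Qed.

Definition first_pos n : {set signed n} := [set v : signed n | v.2 == 0 :> nat].

Lemma first_pos_opposite n (e : rel 'I_n) :
  {in first_pos n &, forall u v, u != v -> double_adj e u v || opposite n u v}.
Proof.
move=> [e1 i] [e2 j] /[!inE] /= /eqP i0 /eqP j0; have -> : i = j by apply: val_inj; rewrite /= i0.
rewrite /opposite /double_adj /opp_signed /= !xpair_eqE eqxx andbT => ne.
by rewrite (_ : e2 == ~~ e1) ?orbT // ; case: e1 e2 ne => -[].
Qed.

(** * Recurrence for strips of the double path *)

Section PathRecurrence.
Variable n : nat.
Implicit Types (M L R : pred bool).

Definition segment (e : bool) (c : nat) : {set signed n.+1} :=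
  [set v : signed n.+1 | (v.1 == e) && (v.2 < c)%N].

Lemma segmentE e c : (c <= n.+1)%N ->
  segment e c = sign_arc n 0 e @: [set: 'I_c].
Proof.
move=> cn; apply/setP => -[e' i]; rewrite inE /=; apply/andP/imsetP.
  case=> /eqP -> ic; exists (Ordinal ic); rewrite ?inE //; congr (_, _).
  apply: ord_inj; have := arc_posE (a := 0) (isT : (0 <= n.+1)%N) cn (Ordinal ic).
  by rewrite -[nat_of_ord (Ordinal ic)]/(nat_of_ord i); have := ltn_ord i; lia.
case=> j _ /eqP; rewrite xpair_eqE => /andP[/eqP -> /eqP ->]; have := arc_posE (a := 0) (isT : (0 <= n.+1)%N) cn j.
by have := ltn_ord j; lia.
Qed.

Lemma connected_segment e c : (c <= n.+1)%N ->
  connected_in (double_path n.+1) (segment e c).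
Proof.
move=> cn; rewrite segmentE // (@connected_in_imset _ _ (path_graph c)) ?connected_path //.
  by move=> i j _ _; apply: sign_arc_inj.
by move=> i j _ _; rewrite /= /double_adj /= eqxx path_adj_arc.
Qed.

Lemma ptubing_poly_segment e c : (c <= n.+1)%N ->
  ptubing_poly (double_path n.+1) (opposite _) (segment e c) = path_poly c.
Proof.
move=> cn; rewrite segmentE //; apply: ptubing_poly_imset => i j _ _.
- exact: sign_arc_inj.
- by rewrite /= /double_adj /= eqxx path_adj_arc.
- exact/negbTE/(no_opposite_sign (e := e)).
Qed.

(** No edge joins the two signs and the edges of one sign form a path, so a connected set through
    the first position is an initial segment of one sign. *)
Lemma strip_tubes M L R t :
  (t \in tubes (double_path n.+1) (opposite _) (strip n.+1 M L R))
    && ~~ [disjoint t & first_pos n.+1] ->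
  exists p : bool * 'I_n.+1,
    [/\ M p.1, L p.1, (p.2 == n :> nat) ==> R p.1 & t = segment p.1 p.2.+1].
Proof.
case/andP => /tubesP[t0 tX /connected_inP conn topp].
case/pred0Pn => -[e i0] /andP[/= et /[!inE] /eqP /= i00].
(* The least such [c] is the first position absent from [t] on sign [e], or [n.+1] if none is; the
   segment before it is closed under adjacency inside [t]. *)
pose miss c := (c == n.+1) || [exists i : 'I_n.+1, (i == c :> nat) && ((e, i) \notin t)].
have [c missc cmin] : exists2 c, miss c & forall d, miss d -> (c <= d)%N.
  have ex : exists c, miss c by exists n.+1; rewrite /miss eqxx.
  by exists (ex_minn ex); case: ex_minnP.
have cn : (c <= n.+1)%N by apply: cmin; rewrite /miss eqxx.
have inT (i : 'I_n.+1) : (i < c)%N -> (e, i) \in t.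
  move=> ic; apply: contraLR ic => it; rewrite -leqNgt; apply: cmin.
  by apply/orP; right; apply/existsP; exists i; rewrite eqxx.
have c0 : (0 < c)%N.
  rewrite lt0n; apply/negP => /eqP c0; move: missc; rewrite c0 /miss /=.
  case/existsP => i /andP[/eqP i_0]; rewrite (_ : i = i0) ?et //.
  by apply: val_inj; rewrite /= i_0.
have tE : segment e c = t.
  apply: conn.
  - by apply/subsetP => -[e' i] /[!inE] /= /andP[/eqP -> /inT].
  - by apply/set0Pn; exists (e, i0); rewrite inE eqxx /= i00.
  move=> [e1 i] [e2 j] /[!inE] /= /andP[/eqP -> ic] jt.
  rewrite /double_adj /= => /andP[/eqP ee ij]; rewrite -ee eqxx /=.
  move: missc; rewrite /miss => /orP[/eqP ->|/existsP[k /andP[/eqP kc kt]]]; first exact: ltn_ord.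
  have jc : j <> c :> nat.
    by move=> jc; case/negP: kt; rewrite -[k](_ : j = k) ?ee //; apply: val_inj; rewrite /= kc.
  by move: ij; rewrite /path_adj /=; lia.
have cn' : (c.-1 < n.+1)%N by lia.
have := subsetP tX _ et; rewrite inE /= i00 eqxx /= => /and3P[Me Le _].
exists (e, Ordinal cn'); split=> //=; last by rewrite prednK.
apply/implyP => /eqP cnE.
have : (e, ord_max) \in strip n.+1 M L R.
  by apply: (subsetP tX); apply: inT => /=; lia.
by rewrite inE /= eqxx => /and3P[].
Qed.

Lemma segment_tube M L R (p : bool * 'I_n.+1) : M p.1 -> L p.1 -> (p.2 == n :> nat) ==> R p.1 ->
  (segment p.1 p.2.+1 \in tubes (double_path n.+1) (opposite _) (strip n.+1 M L R))
    && ~~ [disjoint segment p.1 p.2.+1 & first_pos n.+1].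
Proof.
case: p => e c /= Me Le Re; have ne : (e, ord0) \in segment e c.+1 by rewrite inE eqxx.
apply/andP; split.
  apply/tubesP; split.
  - by apply/set0Pn; exists (e, ord0).
  - apply/subsetP => -[e' i] /[!inE] /= /andP[/eqP -> ic]; rewrite Me Le implybT /=.
    apply/implyP => i_n; apply: (implyP Re); have := ltn_ord c; lia.
  - by apply: connected_segment.
  - by move=> u v /[!inE] /andP[ue _] /andP[ve _]; apply: no_opposite_sign ue ve.
by apply/pred0Pn; exists (e, ord0); rewrite /= ne inE.
Qed.

Lemma segment_inj : injective (fun p : bool * 'I_n.+1 => segment p.1 p.2.+1).
Proof.
move=> [e c] [e' c'] /= /setP H.
have ee : e = e' by have := H (e, ord0); rewrite !inE /= eqxx => /esym/andP[/eqP].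
rewrite -ee; congr (_, _); apply: val_inj => /=.
have := H (e, c); have := H (e, c'); rewrite !inE /= ee !eqxx /=; lia.
Qed.

Lemma sum_strip_tubes M L R (F : {set signed n.+1} -> {poly rat}) :
  \sum_(t in tubes (double_path n.+1) (opposite _) (strip n.+1 M L R)
          | ~~ [disjoint t & first_pos n.+1]) F t
  = \sum_(e | M e && L e) \sum_(c < n.+1 | (c == n :> nat) ==> R e) F (segment e c.+1).
Proof.
rewrite pair_big_dep /=.
pose D := [set p : bool * 'I_n.+1 | M p.1 && L p.1 && ((p.2 == n :> nat) ==> R p.1)].
rewrite [RHS](eq_bigl (mem D)) => [|p]; last by rewrite !inE.
rewrite -(@big_imset _ _ _ _ _ (fun p : bool * 'I_n.+1 => segment p.1 p.2.+1) D F) /=; last first.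
  by move=> p q _ _; apply: segment_inj.
apply: eq_bigl => t; apply/idP/imsetP => [/strip_tubes[p [Mp Lp Rp ->]]|[p + ->]].
  by exists p; rewrite // inE Mp Lp.
rewrite [p \in D]inE => /andP[/andP[Mp Lp] Rp]; exact: segment_tube.
Qed.

(** On sign [e] the position just after the segment is lost too, being adjacent to it; on the other
    sign only the opposites are lost. This is why the rest excludes [e] from its first position. *)
Lemma nbhd_segment e (c : 'I_n.+1) v :
  (v \in nbhd (double_path n.+1) (opposite _) (segment e c.+1))
  = (v.2 < c.+1 + (v.1 == e))%N.
Proof.
case: v => e' i; rewrite !inE /=; apply/orP/idP => [[/andP[-> ic]|]|ic]; first lia.
  case/exists_inP => -[e1 j] /[!inE] /= /andP[/eqP -> jc] /orP[/andP[/= /eqP <-]|/eqP[-> ->]].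
    by rewrite eqxx /path_adj /=; lia.
  lia.
case: (eqVneq e' e) ic => [-> ic|ne ic].
  case: (ltnP i c.+1) => ic'; [by left|right].
  apply/exists_inP; exists (e, c); rewrite ?inE ?eqxx //=.
  by rewrite /double_adj /path_adj /= eqxx; apply/orP; left; lia.
right; apply/exists_inP; exists (e, i); rewrite ?inE ?eqxx //=; first lia.
by rewrite /opposite /opp_signed /= xpair_eqE eqxx; case: e e' ne {ic} => -[]; rewrite ?orbT.
Qed.

Lemma strip_rest M L R e (c : 'I_n.+1) :
  strip n.+1 M L R :\: nbhd (double_path n.+1) (opposite _) (segment e c.+1)
  = arc_map n c.+1 @: strip (n - c) M (predC1 e) R.
Proof.
apply/setP => -[e' i]; have lt_cn := ltn_ord c; have lt_in := ltn_ord i.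
pose P (b : bool) x := [&& M b, (x == 0)%N ==> predC1 e b & (x.+1 == n - c)%N ==> R b].
rewrite (mem_arc_map _ _ P) /=; [|lia..].
rewrite in_setD nbhd_segment inE /P /=.
by case: (M e') (R e') (L e') (e' == e) => -[] [] []; lia.
Qed.

Lemma strip_drop_first M L R :
  strip n.+1 M L R :\: first_pos n.+1 = arc_map n 1 @: strip n M predT R.
Proof.
apply/setP => -[e i]; have lt_in := ltn_ord i.
pose P (b : bool) x := [&& M b, (x == 0)%N ==> true & (x.+1 == n)%N ==> R b].
by rewrite (mem_arc_map _ _ P) /P //= !inE /=; lia.
Qed.

(** The family is closed: avoiding the first position frees the restriction [L], a segment of sign
    [e] replaces it by the exclusion of [e], while [M] and [R] persist. A segment reaching the last
    position (c = n) must be allowed there by [R]. *)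
Lemma strip_poly_rec M L R :
  strip_poly n.+1 M L R = strip_poly n M predT R + 'X *
    \sum_(e | M e && L e) \sum_(c < n.+1 | (c == n :> nat) ==> R e)
      path_poly c.+1 * strip_poly (n - c) M (predC1 e) R.
Proof.
rewrite {1}/strip_poly (tubing_poly_rec (G := double_path _) (@opposite_sym _) _ (@first_pos_opposite _ _)).
rewrite strip_drop_first strip_poly_shift // sum_strip_tubes.
congr (_ + _ * _); apply: eq_bigr => e _; apply: eq_bigr => c _.
have lt_cn := ltn_ord c.
by rewrite ptubing_poly_segment ?strip_rest ?strip_poly_shift //; lia.
Qed.

End PathRecurrence.

(** * Recurrence for the double cycle *)

Lemma connected_in_sub (T : finType) (G H : sgraph T) (t : {set T}) :
  {in t &, forall u v, adj G u v -> adj H u v} -> connected_in G t -> connected_in H t.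
Proof.
move=> GH /connected_inP conn; apply/connected_inP => A At A0 Acl; apply: conn => //.
by move=> u v uA vt uv; apply: (Acl u) => //; apply: GH => //; apply: (subsetP At).
Qed.

Section CycleRecurrence.
Variable n : nat.
Implicit Types (M : pred bool) (e : bool) (c k : nat).

Definition of_sign M : {set signed n.+1} := [set v : signed n.+1 | M v.1].

(* The arc of sign e left by the gap of the k positions c+1, ..., c+k. *)
Definition cycle_arc e c k : {set signed n.+1} :=
  [set v : signed n.+1 | (v.1 == e) && ((v.2 <= c) || (c + k < v.2))%N].

(** Read as a path, the arc starts right after the gap and wraps through the first position; if the
    gap ends at the last position, the start [n.+1] is read modulo [n.+1]. *)
Lemma cycle_arcE e c k : (0 < k)%N -> (c + k <= n)%N ->
  cycle_arc e c k = sign_arc n (c + k).+1 e @: [set: 'I_(n.+1 - k)].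
Proof.
move=> k0 ckn; apply/setP => -[e' i]; rewrite inE /=.
have ckn' : ((c + k).+1 <= n.+1)%N by [].
have lek : (n.+1 - k <= n.+1)%N by lia.
have lt_in := ltn_ord i; apply/andP/imsetP.
  case=> /eqP -> ic.
  have [lt|ge] := ltnP (c + k) i.
    have jP : (i - (c + k).+1 < n.+1 - k)%N by lia.
    exists (Ordinal jP); rewrite ?inE //; congr (_, _).
    apply: ord_inj; have := arc_posE ckn' lek (Ordinal jP).
    by rewrite -[nat_of_ord (Ordinal jP)]/(i - (c + k).+1)%N; lia.
  have jP : (i + n.+1 - (c + k).+1 < n.+1 - k)%N by lia.
  exists (Ordinal jP); rewrite ?inE //; congr (_, _).
  apply: ord_inj; have := arc_posE ckn' lek (Ordinal jP).
  by rewrite -[nat_of_ord (Ordinal jP)]/(i + n.+1 - (c + k).+1)%N; lia.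
case=> j _ /eqP; rewrite xpair_eqE => /andP[/eqP -> /eqP ->].
by have := arc_posE ckn' lek j; have := ltn_ord j; split=> //; lia.
Qed.

Lemma cycle_arc0 e c : cycle_arc e c 0 = of_sign (pred1 e).
Proof. by apply/setP => -[e' i]; rewrite !inE /= addn0; case: leqP; rewrite andbT. Qed.

Lemma of_signE e : of_sign (pred1 e) = sign_arc n 0 e @: [set: 'I_n.+1].
Proof.
rewrite -segmentE //; apply/setP => -[e' i]; rewrite !inE /=.
by rewrite ltn_ord andbT.
Qed.

Lemma connected_cycle_arc e c k : (c + k <= n)%N ->
  connected_in (double_cycle n.+1) (cycle_arc e c k).
Proof.
case: k => [|k] ckn.
  rewrite cycle_arc0 of_signE -segmentE //.
  apply: connected_in_sub (connected_segment _ _) => // u v _ _.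
  by rewrite /= /double_adj /= => /andP[-> uv]; rewrite /cycle_adj /= uv.
rewrite cycle_arcE // (@connected_in_imset _ _ (path_graph (n.+1 - k.+1))) ?connected_path //.
  by move=> i j _ _; apply: sign_arc_inj; lia.
by move=> i j _ _; rewrite /= /double_adj /= eqxx cycle_adj_arc //; lia.
Qed.

Lemma ptubing_poly_cycle_arc e c k : (0 < k)%N -> (c + k <= n)%N ->
  ptubing_poly (double_cycle n.+1) (opposite _) (cycle_arc e c k) = path_poly (n.+1 - k).
Proof.
move=> k0 ckn; rewrite cycle_arcE //; apply: ptubing_poly_imset => i j _ _.
- by apply: sign_arc_inj; lia.
- by rewrite /= /double_adj /= eqxx cycle_adj_arc //; lia.
- exact/negbTE/(no_opposite_sign (e := e)).
Qed.

Lemma ptubing_poly_of_sign e :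
  ptubing_poly (double_cycle n.+1) (opposite _) (of_sign (pred1 e)) = cycle_poly n.+1.
Proof.
rewrite of_signE; apply: ptubing_poly_imset => i j _ _.
- exact: sign_arc_inj.
- have arc0 (l : 'I_n.+1) : arc_pos n 0 l = l.
    by apply: ord_inj; have := arc_posE (leq0n n.+1) (leqnn n.+1) l; have := ltn_ord l; lia.
  by rewrite /= /double_adj /= !arc0 eqxx.
- exact/negbTE/(no_opposite_sign (e := e)).
Qed.

(* The full cycle has the empty gap, listed only for c = n. *)
Let gap (p : 'I_n.+1 * 'I_n.+1) :=
  (p.2 + p.1 <= n)%N && ((p.1 == 0 :> nat)%N ==> (p.2 == n :> nat)).

Lemma cycle_tubes M t :
  (t \in tubes (double_cycle n.+1) (opposite _) (of_sign M))
    && ~~ [disjoint t & first_pos n.+1] ->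
  exists p : bool * ('I_n.+1 * 'I_n.+1),
    [/\ M p.1, gap p.2 & t = cycle_arc p.1 p.2.2 p.2.1].
Proof.
case/andP => /tubesP[t0 tX /connected_inP conn topp].
case/pred0Pn => -[e i0] /andP[/= et /[!inE] /eqP /= i00].
have Me : M e by have := subsetP tX _ et; rewrite inE.
pose miss (i : 'I_n.+1) := (e, i) \notin t.
have sub c k : (forall i : 'I_n.+1, (i <= c) || (c + k < i) -> (e, i) \in t)%N ->
    (forall i j : 'I_n.+1, (i <= c) || (c + k < i) -> cycle_adj i j -> (e, j) \in t -> (j <= c) || (c + k < j))%N ->
    t = cycle_arc e c k.
  move=> inT cl; apply/esym/conn.
  - by apply/subsetP => -[e' i] /[!inE] /andP[/eqP /= ->]; apply: inT.
  - by apply/set0Pn; exists (e, i0); rewrite inE eqxx /= i00.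
  move=> [e1 i] [e2 j] /[!inE] /= /andP[/eqP -> ic] jt.
  case/andP => /eqP /= ee ij; rewrite -ee eqxx /=.
  by apply: cl ic ij _; rewrite ee.
case: (pickP miss) => [x missx|full].
  (* The gap runs from the first absent position [c] to the last one [d]. What lies outside it is
     closed under adjacency inside [t], so [t] has no point strictly between them. *)
  have [c missc cmin] := @arg_minnP _ x miss (@nat_of_ord _) missx.
  have [d missd dmax] := @arg_maxnP _ x miss (@nat_of_ord _) missx.
  have c0 : (0 < c)%N.
    rewrite lt0n; apply/negP => /eqP c0; case/negP: missc.
    by rewrite (_ : c = i0) //; apply: val_inj; rewrite /= c0.
  have cd : (c <= d)%N := cmin _ missd; have lt_dn := ltn_ord d.
  have kP : (d - c.-1 < n.+1)%N by lia.
  have cP : (c.-1 < n.+1)%N by lia.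
  exists (e, (Ordinal kP, Ordinal cP)); split=> //=; first by rewrite /gap /=; lia.
  apply: sub => [i | i j ic ij jt].
    apply: contraTT => /[dup] /cmin /= ci /dmax /=; lia.
  have jc : j <> c :> nat by move=> /ord_inj jc; case/negP: missc; rewrite -jc.
  have jd : j <> d :> nat by move=> /ord_inj jd; case/negP: missd; rewrite -jd.
  move: ij; rewrite /cycle_adj /path_adj /= -val_eqE /=.
  have := ltn_ord i; have := ltn_ord j; lia.
exists (e, (ord0, ord_max)); split=> //=; first by rewrite /gap /= addn0 leqnn eqxx.
apply: sub => [i _ | i j _ _ _]; last by rewrite -ltnS ltn_ord.
by have := full i; rewrite /miss => /negbFE.
Qed.

Lemma cycle_arc_tube M (p : bool * ('I_n.+1 * 'I_n.+1)) : M p.1 -> gap p.2 ->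
  (cycle_arc p.1 p.2.2 p.2.1 \in tubes (double_cycle n.+1) (opposite _) (of_sign M))
    && ~~ [disjoint cycle_arc p.1 p.2.2 p.2.1 & first_pos n.+1].
Proof.
case: p => e [k c] /= Me /andP[/= ckn _].
have ne : (e, ord0) \in cycle_arc e c k by rewrite inE eqxx.
apply/andP; split.
  apply/tubesP; split.
  - by apply/set0Pn; exists (e, ord0).
  - by apply/subsetP => -[e' i] /[!inE] /= /andP[/eqP ->].
  - exact: connected_cycle_arc.
  - by move=> u v /[!inE] /andP[ue _] /andP[ve _]; apply: no_opposite_sign ue ve.
by apply/pred0Pn; exists (e, ord0); rewrite /= ne inE.
Qed.

Lemma cycle_arc_inj : {in [pred p : bool * ('I_n.+1 * 'I_n.+1) | gap p.2] &,
  injective (fun p : bool * ('I_n.+1 * 'I_n.+1) => cycle_arc p.1 p.2.2 p.2.1)}.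
Proof.
move=> [e [k c]] [e' [k' c']] /andP[/= ckn /implyP c0] /andP[/= ckn' /implyP c0'] /setP H.
have ee : e = e' by have := H (e, ord0); rewrite !inE /= eqxx => /esym/andP[/eqP].
have {}H x : (x <= n)%N -> ((x <= c) || (c + k < x) = (x <= c') || (c' + k' < x))%N.
  by move=> xn; have := H (e, inord x); rewrite !inE /= inordK // ee eqxx.
have [kk cc] : k = k' :> nat /\ c = c' :> nat.
  have lt_cn := ltn_ord c; have lt_cn' := ltn_ord c'.
  (* Two gaps are told apart at their end positions c+1 and c+k; an empty gap has c = n by the
     convention in [gap]. *)
  have H1 := H c.+1; have H2 := H c'.+1; have H3 := H (c + k)%N ckn; have H4 := H (c' + k')%N ckn'.
  lia.
by rewrite ee (ord_inj kk) (ord_inj cc).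
Qed.

Lemma sum_cycle_tubes M (F : {set signed n.+1} -> {poly rat}) :
  \sum_(t in tubes (double_cycle n.+1) (opposite _) (of_sign M)
          | ~~ [disjoint t & first_pos n.+1]) F t
  = \sum_(e | M e) (F (of_sign (pred1 e))
     + \sum_(k < n) \sum_(c < n.+1 | (c + k.+1 <= n)%N) F (cycle_arc e c k.+1)).
Proof.
pose D := [set p : bool * ('I_n.+1 * 'I_n.+1) | M p.1 && gap p.2].
transitivity (\sum_(p in D) F (cycle_arc p.1 p.2.2 p.2.1)).
  rewrite -(@big_imset _ _ _ _ _ (fun p : bool * ('I_n.+1 * 'I_n.+1) => cycle_arc p.1 p.2.2 p.2.1) D F) /=; last first.
    by move=> p q; rewrite !inE => /andP[_ gp] /andP[_ gq]; apply: cycle_arc_inj.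
  apply: eq_bigl => t; apply/idP/imsetP => [/cycle_tubes[p [Mp gp ->]]|[p + ->]].
    by exists p; rewrite // inE Mp.
  by rewrite [p \in D]inE => /andP[Mp gp]; exact: cycle_arc_tube.
rewrite (eq_bigl (fun p => M p.1 && gap p.2)) => [|p]; last by rewrite !inE.
rewrite -(pair_big_dep M (fun _ => gap) (fun e q => F (cycle_arc e q.2 q.1))) /=.
apply: eq_bigr => e _.
rewrite -(pair_big_dep xpredT (fun k c : 'I_n.+1 => gap (k, c)) (fun k c : 'I_n.+1 => F (cycle_arc e c k))) /=.
rewrite big_ord_recl; congr (_ + _).
  rewrite (big_pred1 ord_max) ?cycle_arc0 // => c; rewrite /gap /= -val_eqE /=.
  by have := ltn_ord c; lia.
by apply: eq_bigr => k _; apply: eq_bigl => c; rewrite /gap /= /bump /= add1n andbT.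
Qed.

Lemma nbhd_cycle_arc e c k v : (0 < k)%N -> (c + k <= n)%N ->
  (v \in nbhd (double_cycle n.+1) (opposite _) (cycle_arc e c k))
  = (v.2 < c.+1 + (v.1 == e))%N || (c + k < v.2 + (v.1 == e))%N.
Proof.
move=> k0 ckn; case: v => e' i; rewrite !inE /=; have lt_in := ltn_ord i.
apply/orP/idP => [[/andP[-> ic]|]|ic]; first lia.
  case/exists_inP => -[e1 j] /[!inE] /= /andP[/eqP -> jc] /orP[/andP[/= /eqP <-]|/eqP[-> ->]].
    rewrite eqxx /cycle_adj /path_adj /= -val_eqE /=; have := ltn_ord j; lia.
  lia.
case: (eqVneq e' e) ic => [-> ic|ne ic].
  case: (boolP ((i <= c) || (c + k < i))%N) => ic'; [by left|right].
  have adjE j : (j <= c)%N || (c + k < j)%N -> (j < n.+1)%N -> 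
      ((j.+1 == i) || (i.+1 == j) || [&& j == 0, i.+1 == n.+1 & i != 0 :> nat])%N ->
      [exists u in cycle_arc e c k, double_adj (@cycle_adj n.+1) u (e, i) || opposite _ u (e, i)].
    move=> jc jn ji; apply/exists_inP; exists (e, Ordinal jn); rewrite ?inE ?eqxx //=.
    by rewrite /double_adj /cycle_adj /path_adj /= eqxx -val_eqE /=; apply/orP; left; lia.
  (* A position of the gap next to the arc is its first one, with neighbour [c], or its last one,
     with neighbour [i.+1], or 0 across the closing edge of the cycle. *)
  have [ic1|ic1] := eqVneq (i : nat) c.+1.
    by apply: (adjE c); lia.
  have [ick|ick] := ltnP (c + k) n.
    by apply: (adjE i.+1); lia.
  by apply: (adjE 0%N); lia.
right; apply/exists_inP; exists (e, i); rewrite ?inE ?eqxx //=; first lia.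
by rewrite /opposite /opp_signed /= xpair_eqE eqxx; case: e e' ne {ic} => -[]; rewrite ?orbT.
Qed.

(** Both ends of the gap are adjacent to the arc and lose sign [e]. For [M] full this is a cis
    double path on [k] positions, with [e] in the role of the negative sign. *)
Lemma cycle_rest M e c k : (0 < k)%N -> (c + k <= n)%N ->
  of_sign M :\: nbhd (double_cycle n.+1) (opposite _) (cycle_arc e c k)
  = arc_map n c.+1 @: strip k M (predC1 e) (predC1 e).
Proof.
move=> k0 ckn; apply/setP => -[e' i]; have lt_in := ltn_ord i.
pose P (b : bool) x := [&& M b, (x == 0)%N ==> predC1 e b & (x.+1 == k)%N ==> predC1 e b].
rewrite (mem_arc_map _ _ P) /=; [|lia..].
rewrite in_setD nbhd_cycle_arc // inE /P /=.
by case: (M e') (e' == e) => -[]; lia.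
Qed.

Lemma cycle_rest_full M e :
  of_sign M :\: nbhd (double_cycle n.+1) (opposite _) (of_sign (pred1 e)) = set0.
Proof.
apply/setP => -[e' i]; rewrite !inE /=; apply/negbTE; rewrite negb_and negbK; apply/orP; left.
case: eqVneq => //= ne; apply/exists_inP; exists (e, i); rewrite ?inE //=.
by rewrite /opposite /opp_signed /= xpair_eqE eqxx; case: e e' ne => -[]; rewrite ?orbT.
Qed.

Lemma cycle_drop_first M :
  of_sign M :\: first_pos n.+1 = arc_map n 1 @: strip n M predT predT.
Proof.
apply/setP => -[e i]; have lt_in := ltn_ord i.
pose P (b : bool) x := [&& M b, (x == 0)%N ==> true & (x.+1 == n)%N ==> true].
by rewrite (mem_arc_map _ _ P) /P //= !inE /=; lia.
Qed.

(** The multiplicity [n - k] counts the arcs of [n - k] positions through the first one; it becomes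
    the derivative in the generating function. The full cycle leaves nothing, as it and its
    opposites exhaust the vertices. *)
Lemma cycle_tubing_poly_rec M :
  tubing_poly (double_cycle n.+1) (opposite _) (of_sign M)
  = strip_poly n M predT predT + 'X * \sum_(e | M e) (cycle_poly n.+1
     + \sum_(k < n) path_poly (n - k) * strip_poly k.+1 M (predC1 e) (predC1 e) *+ (n - k)).
Proof.
rewrite (tubing_poly_rec (G := double_cycle _) (@opposite_sym _) _ (@first_pos_opposite _ _)).
rewrite cycle_drop_first strip_poly_shift_cycle // sum_cycle_tubes.
congr (_ + _ * _); apply: eq_bigr => e _.
rewrite ptubing_poly_of_sign cycle_rest_full tubing_poly_set0 mulr1; congr (_ + _).
apply: eq_bigr => k _; have lt_kn := ltn_ord k.
transitivity (\sum_(c < n.+1 | (c + k.+1 <= n)%N)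
    path_poly (n - k) * strip_poly k.+1 M (predC1 e) (predC1 e)).
  apply: eq_bigr => c ckn.
  by rewrite ptubing_poly_cycle_arc ?cycle_rest ?strip_poly_shift_cycle ?subSS //; lia.
rewrite (eq_bigl (fun c : 'I_n.+1 => (c < n - k)%N)) => [|c]; last by lia.
rewrite -(big_ord_widen n.+1 (fun=> _)); last by lia.
by rewrite sumr_const card_ord.
Qed.

End CycleRecurrence.

(** * Tubings as cliques, and homogenization by dimension *)

(** Opposite vertices of two nested tubes would both lie in the larger one, which is excluded for a
    tube; for disjoint tubes their absence is part of [separated]. *)
Lemma hc_tubing_cliques n (G : sgraph (signed n)) (N : {set {set signed n}}) :
  hc_tubing G N
  = (N \in cliques (tube_compat G (opposite n)) (tubes G (opposite n) (verts G))).
Proof.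
apply/and3P/cliquesP => [[/forall_inP tN /forall_inP cN /forall_inP oN]|[/subsetP tN cN]].
  have opp s t u v : s \in N -> t \in N -> u \in s -> v \in t -> ~~ opposite n u v.
    move=> sN tN' us vt; apply/eqP => vE.
    have uN : u \in cover N by apply/bigcupP; exists s.
    by have /negP[] := oN u uN; apply/bigcupP; exists t; rewrite -?vE.
  split.
    apply/subsetP => t tt; have /and4P[t0 tG tc _] := tN t tt; apply/tubesP; split=> //.
    by move=> u v; apply: (opp t t).
  move=> s t sN tN'; have /forall_inP/(_ t tN')/or3P[||/andP[dst nadj]] := cN s sN.
  - by rewrite /tube_compat => ->.
  - by rewrite /tube_compat => ->; rewrite orbT.
  rewrite /tube_compat; apply/or3P/Or33/andP; split=> //.
  apply/forall_inP => u us; apply/forall_inP => v vt; apply/norP; split; last exact: (opp s t).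
  apply: contra nadj => uv; apply/exists_inP; exists u => //; apply/exists_inP; by exists v.
split.
- apply/forall_inP => t /tN/tubesP[t0 tG tc to]; apply/and4P; split=> //.
  apply/forall_inP => v vt; apply/negP => vt'; have /negP[] := to _ _ vt vt'.
  exact: eqxx.
- apply/forall_inP => s sN; apply/forall_inP => t tN'; rewrite /compatible.
  have /or3P[->|->|/separatedP sep] := cN s t sN tN'; rewrite ?orbT //.
  apply/or3P/Or33/andP; split.
    by apply/pred0P => u /=; apply/negbTE/negP => /andP[us ut]; have [] := sep u u us ut.
  by apply/negP => /exists_inP[u us /exists_inP[v vt uv]]; have [_ /negP] := sep u v us vt.
apply/forall_inP => v /bigcupP[s sN vs]; apply/negP => /bigcupP[t tN' vt].
have nopp r : r \in N -> v \in r -> opp_signed v \in r -> False.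
  by move=> /tN/tubesP[_ _ _ ro] vr vr'; have /negP[] := ro _ _ vr vr'; exact: eqxx.
have /or3P[/subsetP st|/subsetP ts|/separatedP sep] := cN s t sN tN'.
- by apply: (nopp t) => //; apply: st.
- by apply: (nopp s) => //; apply: ts.
by have [_ _ /negP[]] := sep _ _ vs vt; exact: eqxx.
Qed.

Lemma graph_tubing_cliques (T : finType) (G : sgraph T) (N : {set {set T}}) :
  graph_tubing G N = (N \in cliques (tube_compat G (no_opposition T))
                                    (tubes G (no_opposition T) (verts G) :\ verts G)).
Proof.
have tubeE t : graph_tube G t = (t \in tubes G (no_opposition T) (verts G) :\ verts G).
  rewrite in_setD1; apply/and3P/andP => [[t0 tG tc]|[tG /tubesP[t0 tG' tc _]]].
    by move: tG; rewrite properEneq => /andP[-> tG]; split=> //; apply/tubesP.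
  by split=> //; rewrite properEneq tG.
apply/andP/cliquesP => [[/forall_inP tN /forall_inP cN]|[/subsetP tN cN]].
  split; first by apply/subsetP => t /tN; rewrite tubeE.
  move=> s t sN tN'; have /forall_inP/(_ t tN')/or3P[||/andP[dst nadj]] := cN s sN.
  - by rewrite /tube_compat => ->.
  - by rewrite /tube_compat => ->; rewrite orbT.
  rewrite /tube_compat; apply/or3P/Or33/andP; split=> //.
  apply/forall_inP => u us; apply/forall_inP => v vt; rewrite orbF.
  by apply: contra nadj => uv; apply/exists_inP; exists u => //; apply/exists_inP; exists v.
split; first by apply/forall_inP => t /tN; rewrite tubeE.
apply/forall_inP => s sN; apply/forall_inP => t tN'; rewrite /compatible.
have /or3P[->|->|/separatedP sep] := cN s t sN tN'; rewrite ?orbT //.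
apply/or3P/Or33/andP; split.
  by apply/pred0P => u /=; apply/negbTE/negP => /andP[us ut]; have [] := sep u u us ut.
by apply/negP => /exists_inP[u us /exists_inP[v vt uv]]; have [_ /negP] := sep u v us vt.
Qed.

Lemma cis_tubing_cliques n (N : {set {set signed n}}) :
  hc_tubing (cis_double_path n) N
  = (N \in cliques (tube_compat (double_path n) (opposite n))
             (tubes (double_path n) (opposite n) (strip n predT (predC1 false) (predC1 false)))).
Proof.
rewrite hc_tubing_cliques (_ : verts _ = strip n predT (predC1 false) (predC1 false)) //.
by apply/setP => v; rewrite !inE /=; case: v.1; rewrite ?implybT ?implybF.
Qed.

(* If p counts the tubings of an n-dimensional polytope by their number of
   tubes, then homog n p is its f-polynomial. *)
Definition homog n (p : {poly rat}) : {poly rat} := \sum_(k < n.+1) p`_k *: 'X^(n - k).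

Lemma coef_homog n p i : (homog n p)`_i = if (i <= n)%N then p`_(n - i) else 0.
Proof.
rewrite /homog coef_sum; case: ifPn => ni; last first.
  rewrite big1 // => k _; rewrite coefZ coefXn; case: eqP => [ik|]; last by rewrite mulr0.
  by move: ni; rewrite ik leq_subr.
have lt : (n - i < n.+1)%N by lia.
rewrite (bigD1 (Ordinal lt)) //= coefZ coefXn subKn // eqxx mulr1 big1 ?addr0 // => k.
rewrite -val_eqE /= => kn; rewrite coefZ coefXn; have := ltn_ord k.
by case: eqP => [ik lt_kn|]; rewrite ?mulr0 //; move: kn; rewrite ik; lia.
Qed.

Lemma homogD n p q : homog n (p + q) = homog n p + homog n q.
Proof. by apply/polyP => i; rewrite coefD !coef_homog; case: ifP; rewrite ?addr0 ?coefD. Qed.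

Lemma homog0 n : homog n 0 = 0.
Proof. by apply/polyP => i; rewrite !coef_homog !coef0 if_same. Qed.

Lemma homog_sum n (I : Type) (r : seq I) (P : pred I) (F : I -> {poly rat}) :
  homog n (\sum_(i <- r | P i) F i) = \sum_(i <- r | P i) homog n (F i).
Proof. exact: (big_morph _ (homogD n) (homog0 n)). Qed.

Lemma homogMn n p k : homog n (p *+ k) = homog n p *+ k.
Proof. by elim: k => [|k IH]; rewrite ?mulr0n ?homog0 // !mulrS homogD IH. Qed.

(** One more tube uses up one more dimension, so the power of x does not change. *)
Lemma homogXM n p : homog n.+1 ('X * p) = homog n p.
Proof.
apply/polyP => i; rewrite !coef_homog coefXM subn_eq0.
have [le_in|lt_ni] := leqP i n; last by rewrite if_same.
by rewrite leqW // subSn.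
Qed.

(** A dimension without a tube is a factor x. The degree bound ensures that [homog n] truncates
    nothing; the same holds for products below. *)
Lemma homogS n (p : {poly rat}) : (size p <= n.+1)%N -> homog n.+1 p = 'X * homog n p.
Proof.
move=> sp; apply/polyP => -[|i]; rewrite coefXM !coef_homog //=.
by rewrite subn0 nth_default.
Qed.

Lemma homogM n m (p q : {poly rat}) : (size p <= n.+1)%N -> (size q <= m.+1)%N ->
  homog (n + m) (p * q) = homog n p * homog m q.
Proof.
move=> sp sq.
have polyE k (r : {poly rat}) : (size r <= k.+1)%N -> r = \sum_(i < k.+1) r`_i *: 'X^i.
  by move=> sr; rewrite -poly_def; apply/polyP => i; rewrite coef_poly; case: ltnP => // ki; rewrite nth_default // (leq_trans sr).
have homogX k i : (i <= k)%N -> homog k 'X^i = 'X^(k - i).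
  move=> ik; apply/polyP => j; rewrite coef_homog !coefXn.
  case: leqP => jk; first by congr (nat_of_bool _)%:R; lia.
  by rewrite (_ : (j == _) = false) //; lia.
have homogZ k a r : homog k (a *: r) = a *: homog k r.
  by apply/polyP => i; rewrite coefZ !coef_homog; case: ifP; rewrite ?mulr0 ?coefZ.
rewrite {1}(polyE n p sp) {1}(polyE m q sq) big_distrlr /= homog_sum.
rewrite [in RHS]/homog big_distrlr /=; apply: eq_bigr => i _; rewrite homog_sum; apply: eq_bigr => j _.
have := ltn_ord i; have := ltn_ord j; rewrite !ltnS => jm ni.
rewrite -scalerAl -scalerAr scalerA -exprD -[RHS]scalerAl -scalerAr scalerA homogZ homogX; last lia.
by rewrite -exprD; congr (_ *: 'X^_); lia.
Qed.

(** * Generating functions *)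

Section FpsExtra.
Variable K : comNzRingType.
Implicit Types f g : fps K.

Lemma fps_derivD f g : fps_deriv (f + g) = fps_deriv f + fps_deriv g.
Proof. by apply/fpsP => n; rewrite /= mulrnDl. Qed.

Lemma fps_derivM f g : fps_deriv (f * g) = fps_deriv f * g + f * fps_deriv g.
Proof.
apply/fpsP => n; set P := fps_trunc n.+2 f; set Q := fps_trunc n.+2 g.
have PE i : (i <= n.+1)%N -> P`_i = f i by move=> lt; rewrite coef_poly ltnS lt.
have QE i : (i <= n.+1)%N -> Q`_i = g i by move=> lt; rewrite coef_poly ltnS lt.
transitivity ((P * Q)^`()`_n).
  by rewrite coef_deriv -fps_mul_trunc.
rewrite derivM coefD !coefM fps_coefD !fps_coefM; congr (_ + _).
  apply: eq_bigr => i _; have lt_in := ltn_ord i.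
  by rewrite coef_deriv PE ?QE //; lia.
apply: eq_bigr => i _; have lt_in := ltn_ord i.
by rewrite coef_deriv PE ?QE //; lia.
Qed.

Lemma fps_deriv1 : fps_deriv (1 : fps K) = 0.
Proof. by apply/fpsP => n; rewrite /= mul0rn. Qed.

Lemma fps_derivX : fps_deriv (fpsX : fps K) = 1.
Proof. by apply/fpsP => -[|n]; rewrite /= ?mul0rn. Qed.

Lemma fps_derivC c : fps_deriv (fpsC c : fps K) = 0.
Proof. by apply/fpsP => n; rewrite /= mul0rn. Qed.

End FpsExtra.

Lemma fps_unit1 (K : comUnitRingType) (f : fps K) : f 0%N = 1 -> f \is a GRing.unit.
Proof. by move=> f0; rewrite -[_ \is a _]/(f 0%N \is a GRing.unit) f0 unitr1. Qed.

Lemma fps_unit_1B (K : comUnitRingType) (f : fps K) : f 0%N = 0 -> 1 - f \is a GRing.unit.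
Proof. by move=> f0; apply: fps_unit1; rewrite fps_coefB f0 fps_coef1 subr0. Qed.

(* The cyclohedra and the tubings of the double path have the same
   f-polynomials: both sides equal W (1 + u) / (1 - (1 + x) u ^ 2). *)
Lemma cycle_double_path_eq (K : comUnitRingType) (x y u v W Z B D : K) :
    1 - x * y * (1 + u) \is a GRing.unit ->
    1 - y * (W + (1 + u) * (1 + x)) \is a GRing.unit ->
    1 - u - x * y * (1 + u) \is a GRing.unit ->
    u = y * (1 + u) * W -> W = 1 + (1 + x) * u ->
    v * (1 - y * (W + (1 + u) * (1 + x))) = u ->
    Z * (1 - x * y * (1 + u)) = 1 -> B = W + v * Z ->
    D * (1 - u - x * y * (1 + u)) = 1 + u ->
  B = D.
Proof.
set q := 1 - x * y * (1 + u); set d := 1 - _; set r := 1 - u - _.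
move=> qU dU rU hu hW hv hZ -> hD.
have Wq : W * q = 1 + u.
  transitivity (W - x * (y * (1 + u) * W)); first by rewrite /q; ring.
  by rewrite -hu hW; ring.
(* [d] is the derivative in u of u - y (1 + u) (1 + (1 + x) u), which vanishes by the functional
   equation. *)
have rd : r = (1 + u) * d.
  apply/eqP; rewrite -subr_eq0; apply/eqP.
  transitivity (y * (1 + u) * W - u + y * (1 + u) * (1 + (1 + x) * u) - u).
    by rewrite /r /d; ring.
  by rewrite -hW -!hu subrr add0r subrr.
have qE : q = r + u by rewrite /q /r; ring.
have qdrU : q * d * r \is a GRing.unit by rewrite !unitrM qU dU.
(* With denominators cleared the claim reads (1 + u) d r + u r = q d (1 + u), which follows from q =
   r + u and r = (1 + u) d. *)
apply: (mulIr qdrU).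
transitivity (W * q * (d * r) + v * d * (Z * q) * r); first by ring.
transitivity (q * d * (D * r)); last by ring.
rewrite Wq hv hZ hD qE [X in _ + _ * X]rd; ring.
Qed.

(** Only E + E' enters the equation of D, and adding the other two gives a linear system in D and E
    + E'. *)
Lemma double_path_gf_eq (K : comNzRingType) (x y u D E E' : K) :
    D = 1 + x * y * D + u * (E + E') ->
    E = 1 + x * y * D + u * E' -> E' = 1 + x * y * D + u * E ->
  D * (1 - u - x * y * (1 + u)) = 1 + u.
Proof.
move=> hD hE hE'; have hS : (E + E') * (1 - u) = 2%:R * (1 + x * y * D).
  transitivity ((E - u * E') + (E' - u * E)); first by ring.
  by rewrite {1}hE {3}hE'; ring.
transitivity ((D - (x * y * D + u * (E + E'))) * (1 - u)
   + u * ((E + E') * (1 - u)) - 2%:R * x * y * u * D); first by ring.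
by rewrite hS {1}hD; ring.
Qed.

(* H, C and T stand for the strips whose last position excludes one sign, and
   whose first position excludes no sign, the same sign and the other sign. *)
Lemma cis_gf_eq (K : comUnitRingType) (x y u H C T : K) :
    H = 1 + x * y * H + u * (C - 1 + T) ->
    C = 1 + x * y * H + u * T -> T = 1 + x * y * H + u * (C - 1) ->
  H * (1 - u - x * y * (1 + u)) = 1
  /\ C * (1 - u ^+ 2) = (1 + x * y * H) * (1 + u) - u ^+ 2.
Proof.
move=> hH hC hT; split; last first.
  transitivity (C - u * (u * C)); first by ring.
  transitivity (C - u * (T - (1 + x * y * H) + u)).
    by rewrite [in RHS]hT; ring.
  by rewrite {1}hC; ring.
have hS : (C - 1 + T) * (1 - u) = 1 + 2%:R * x * y * H.
  transitivity ((C - u * T) - 1 + (T - u * (C - 1))); first by ring.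
  by rewrite {1}hC {3}hT; ring.
transitivity ((H - (x * y * H + u * (C - 1 + T))) * (1 - u)
   + u * ((C - 1 + T) * (1 - u)) - 2%:R * x * y * u * H); first by ring.
by rewrite hS {1}hH; ring.
Qed.

(** * Recurrences as equations between power series *)

Section GeneratingFunctions.

(* Unlike in path_poly, the whole path counts as a tube. *)
Definition weak_path_poly n := strip_poly n (pred1 true) predT predT.

(* With a single sign available, excluding it from the first position removes
   that position. *)
Lemma strip_poly_skip n R :
  strip_poly n.+1 (pred1 true) (predC1 true) R = strip_poly n (pred1 true) predT R.
Proof. by rewrite strip_poly_rec big_pred0 ?mulr0 ?addr0 // => -[]. Qed.

Lemma of_sign_tube n e : of_sign n (pred1 e) \in tubes (double_cycle n.+1) (opposite _) (of_sign n (pred1 e)).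
Proof.
apply/tubesP; split=> //; first by apply/set0Pn; exists (e, ord0); rewrite inE /=.
  by rewrite -(cycle_arc0 n e 0); apply: connected_cycle_arc.
by move=> u v; rewrite !inE; apply: no_opposite_sign.
Qed.

Lemma weak_path_polyS n : weak_path_poly n.+1 = (1 + 'X) * path_poly n.+1.
Proof.
have stripE : strip n.+1 (pred1 true) predT predT = segment n true n.+1.
  by apply/setP => -[e i]; rewrite !inE /= ltn_ord !implybT.
rewrite /weak_path_poly /strip_poly stripE tubing_poly_tube ?ptubing_poly_segment //.
  exact: opposite_sym.
apply/tubesP; split=> //; first by apply/set0Pn; exists (true, ord0); rewrite inE.
  exact: connected_segment.
by move=> u v /[!inE] /andP[ue _] /andP[ve _]; apply: no_opposite_sign ue ve.
Qed.

(** In the strip recurrence for a single sign, the term of the whole path cancels the summand X of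
    the factor 1 + X. *)
Lemma path_poly_rec n :
  path_poly n.+1 = weak_path_poly n
    + 'X * \sum_(c < n) path_poly c.+1 * weak_path_poly (n - c.+1).
Proof.
have := strip_poly_rec n (pred1 true) predT predT; rewrite -!/(weak_path_poly _) weak_path_polyS.
rewrite (big_pred1 true) => [|[]] //; rewrite (eq_bigl xpredT) => [|c]; last by rewrite implybT.
rewrite big_ord_recr /= subnn strip_poly0 mulr1 mulrDl mul1r mulrDr addrA => /addIr ->.
congr (_ + _ * _); apply: eq_bigr => c _; have lt_cn := ltn_ord c.
by rewrite (_ : n - c = (n - c.+1).+1)%N ?strip_poly_skip //; lia.
Qed.

Lemma cycle_poly_rec n :
  cycle_poly n.+1 = weak_path_poly n
    + 'X * \sum_(k < n) path_poly (n - k) * strip_poly k (pred1 true) predT (predC1 true) *+ (n - k).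
Proof.
have := cycle_tubing_poly_rec n (pred1 true).
rewrite (tubing_poly_tube (@opposite_sym _) (of_sign_tube n true)) ptubing_poly_of_sign.
rewrite -/(weak_path_poly _) (big_pred1 true) => [|[]] //.
rewrite mulrDl mul1r mulrDr addrA addrAC => /addIr ->.
by congr (_ + _ * _); apply: eq_bigr => k _; rewrite strip_poly_skip.
Qed.

Lemma size_sum_leq (I : finType) (P : pred I) (F : I -> {poly rat}) m :
  (forall i, P i -> (size (F i) <= m)%N) -> (size (\sum_(i | P i) F i)%R <= m)%N.
Proof.
move=> H; elim/big_ind: _ => [|p q sp sq|//]; first by rewrite size_poly0.
by rewrite (leq_trans (size_polyD _ _)) // geq_max sp.
Qed.

Lemma size_XM_leq (p : {poly rat}) m : (size p <= m)%N -> (size ('X * p)%R <= m.+1)%N.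
Proof. by move=> sp; rewrite (leq_trans (size_polyMleq _ _)) // size_polyX. Qed.

Lemma size_M_leq (p q : {poly rat}) m k : (size p <= m.+1)%N -> (size q <= k.+1)%N ->
  (size (p * q)%R <= (m + k).+1)%N.
Proof. by move=> sp sq; rewrite (leq_trans (size_polyMleq _ _)) //; lia. Qed.

(** The recurrence itself bounds the number of tubes by the dimension, so homogenization loses no
    coefficient. *)
Lemma size_path_poly n : (size (path_poly n.+1) <= n.+1)%N.
Proof.
elim/ltn_ind: n => n IH.
have sw m : (m <= n)%N -> (size (weak_path_poly m) <= m.+1)%N.
  case: m => [|m] mn; first by rewrite /weak_path_poly strip_poly0 size_poly1.
  rewrite weak_path_polyS (leq_trans (size_polyMleq _ _)) // addrC size_XaddC.
  by have := IH m mn; lia.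
rewrite path_poly_rec (leq_trans (size_polyD _ _)) // geq_max sw //=.
apply: size_XM_leq; apply: size_sum_leq => c _; have lt_cn := ltn_ord c.
apply: leq_trans (size_M_leq (IH c lt_cn) (sw _ _)) _; lia.
Qed.

Lemma size_strip_poly n M L R : (size (strip_poly n M L R) <= n.+1)%N.
Proof.
elim/ltn_ind: n L => -[|n] IH L; first by rewrite strip_poly0 size_poly1.
rewrite strip_poly_rec (leq_trans (size_polyD _ _)) // geq_max leqW ?IH //=.
apply: size_XM_leq; apply: size_sum_leq => e _; apply: size_sum_leq => c _.
have lt_cn := ltn_ord c.
apply: leq_trans (size_M_leq (size_path_poly c) (IH _ _ _)) _; lia.
Qed.

Lemma fps_coefXM (K : comNzRingType) (f : fps K) n :
  (fpsX * f) n = if n is m.+1 then f m else 0.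
Proof.
rewrite fps_coefM; case: n => [|n]; first by rewrite big_ord1 mul0r.
by rewrite big_ord_recl mul0r add0r big_ord_recl mul1r big1 ?addr0 ?subSS ?subn0 // => i _; rewrite mul0r.
Qed.

(** Indexed by dimension; in [y * path_gf] the exponent of y is the number of vertices of the
    path. *)
Definition path_gf : fps {poly rat} := Fps (fun n => homog n (path_poly n.+1)).
Definition cycle_gf : fps {poly rat} := Fps (fun n => homog n (cycle_poly n.+1)).
Definition double_cycle_gf : fps {poly rat} :=
  Fps (fun n => homog n (tubing_poly (double_cycle n) (opposite n) setT)).
Definition strip_gf M L R : fps {poly rat} := Fps (fun n => homog n (strip_poly n M L R)).

Lemma homog1 : homog 0 1 = 1.
Proof. by rewrite /homog big_ord1 coef1 scale1r. Qed.

Local Notation x := x_var.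
Local Notation y := (fpsX : fps {poly rat}).
Local Notation u := (y * path_gf).

(** The subtracted 1 is the empty strip left by a segment that reaches the last position, which is
    forbidden when [R e] fails. *)
Lemma strip_gf_eq M L R :
  strip_gf M L R = 1 + x_var * y * strip_gf M predT R
    + y * path_gf * \sum_(e | M e && L e) (strip_gf M (predC1 e) R - (~~ R e)%:R).
Proof.
apply/fpsP => -[|n].
  by rewrite !fps_coefD -!mulrA fps_coefCM !fps_coefXM mulr0 !addr0 /= strip_poly0 homog1.
rewrite !fps_coefD -!mulrA fps_coefCM !fps_coefXM add0r [LHS]/=.
rewrite strip_poly_rec homogD homogXM homogS ?size_strip_poly //; congr (_ + _).
rewrite mulr_sumr fps_coef_sum homog_sum; apply: eq_bigr => e _.
rewrite homog_sum fps_coefM big_mkcond; apply: eq_bigr => c _.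
have le_cn : (c <= n)%N by rewrite -ltnS.
rewrite fps_coefB; have -> : ((~~ R e)%:R : fps {poly rat}) (n - c)%N = ((~~ R e) && (c == n :> nat))%:R.
  case: (R e) => //; transitivity ((1 : fps {poly rat}) (n - c)%N) => //.
  by rewrite fps_coef1 subn_eq0 eqn_leq le_cn.
case: (eqVneq (c : nat) n) => [->|_] /=; last first.
  by rewrite andbF subr0 -{1}(subnKC le_cn) homogM ?size_path_poly ?size_strip_poly.
rewrite andbT subnn strip_poly0 homog1 mulr1.
by case: (R e); rewrite ?subr0 ?mulr1 ?subrr ?mulr0.
Qed.

Lemma path_gf_eq :
  path_gf = strip_gf (pred1 true) predT predT * (1 + y * path_gf).
Proof.
set W := strip_gf _ _ _; rewrite mulrDr mulr1 mulrCA [W * _]mulrC.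
apply/fpsP => n; rewrite fps_coefD fps_coefXM [LHS]/= path_poly_rec homogD; congr (_ + _).
case: n => [|n]; first by rewrite big_ord0 mulr0 homog0.
rewrite homogXM homog_sum fps_coefM; apply: eq_bigr => c _.
have le_cn : (c <= n)%N by rewrite -ltnS.
by rewrite subSS -{1}(subnKC le_cn) homogM ?size_path_poly ?size_strip_poly.
Qed.

(** The whole path is taken as a tube or not: after homogenization the factor 1 + X becomes x +
    1. *)
Lemma weak_path_gf_eq :
  strip_gf (pred1 true) predT predT = 1 + (1 + x_var) * (y * path_gf).
Proof.
apply/fpsP => -[|n]; rewrite mulrDl mul1r !fps_coefD fps_coefCM !fps_coefXM /=.
  by rewrite mulr0 !addr0 strip_poly0 homog1.
rewrite add0r -/(weak_path_poly _) weak_path_polyS mulrDl mul1r homogD homogXM.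
by rewrite homogS ?size_path_poly // addrC.
Qed.

(** The operator y d/dy multiplies the coefficient of y^(n-k) by [n - k], the number of arcs of that
    length. *)
Lemma sum_arcs (F : nat -> {poly rat}) (f g : fps {poly rat}) n :
    (forall k, (k < n)%N -> F k = f (n - k.+1)%N * g k) -> 
  \sum_(k < n) F k *+ (n - k) = (y * fps_deriv (y * f) * g) n.
Proof.
move=> FE; rewrite -mulrA fps_coefXM; case: n FE => [|n] FE; first by rewrite big_ord0.
rewrite [_ * g]mulrC fps_coefM; apply: eq_bigr => k _.
have le_kn : (k <= n)%N by rewrite -ltnS.
have -> : fps_deriv (y * f) (n - k)%N = f (n - k)%N *+ (n - k).+1.
  by rewrite -[LHS]/((y * f) (n - k).+1 *+ (n - k).+1) fps_coefXM.
by rewrite FE // subSS subSn // mulrnAr mulrC.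
Qed.

Lemma cycle_gf_eq :
  cycle_gf = strip_gf (pred1 true) predT predT
    + y * fps_deriv (y * path_gf) * strip_gf (pred1 true) predT (predC1 true).
Proof.
apply/fpsP => n; rewrite fps_coefD [LHS]/= cycle_poly_rec homogD; congr (_ + _).
case: n => [|n]; first by rewrite big_ord0 mulr0 homog0 -mulrA fps_coefXM.
rewrite homogXM homog_sum.
pose F k := homog n (path_poly (n.+1 - k) * strip_poly k (pred1 true) predT (predC1 true)).
rewrite -(sum_arcs (F := F)) => [|k]; first by apply: eq_bigr => k _; rewrite homogMn.
rewrite ltnS /F => le_kn; rewrite subSS subSn //= -{1}(subnK le_kn).
by rewrite homogM ?size_path_poly ?size_strip_poly.
Qed.

Lemma double_cycle_gf_eq :
  double_cycle_gf = 1 + x_var * y * strip_gf predT predT predT + 2%:R * y * cycle_gf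
    + y * fps_deriv (y * path_gf) * \sum_(e : bool) (strip_gf predT (predC1 e) (predC1 e) - 1).
Proof.
have -> : 2%:R * y * cycle_gf = y * \sum_(e : bool) cycle_gf.
  by rewrite big_bool /= mulrDr -mulrA mulr_natl.
rewrite -!mulrA -addrA -mulrDr mulr_sumr -big_split /=.
apply/fpsP => -[|n].
  rewrite !fps_coefD fps_coefCM !fps_coefXM mulr0 !addr0 /=.
  rewrite (_ : setT = set0) ?tubing_poly_set0 ?homog1 //.
  by apply/setP => -[? []].
rewrite !fps_coefD fps_coefCM !fps_coefXM add0r [LHS]/=.
rewrite (_ : setT = of_sign n predT); last by apply/setP => v; rewrite !inE.
rewrite cycle_tubing_poly_rec homogD homogXM homogS ?size_strip_poly //; congr (_ + _).
rewrite homog_sum fps_coef_sum; apply: eq_bigr => e _.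
rewrite homogD fps_coefD; congr (_ + _).
(* A gap has at least one position, so the constant term 1 is removed and the remaining series is
   divisible by y. *)
pose g : fps {poly rat} := Fps (fun k => strip_gf predT (predC1 e) (predC1 e) k.+1).
have -> : strip_gf predT (predC1 e) (predC1 e) - 1 = y * g.
  apply/fpsP => k; rewrite fps_coefB fps_coefXM fps_coef1.
  by case: k => [|k]; rewrite /= ?subr0 // strip_poly0 homog1 subrr.
rewrite mulrCA mulrA homog_sum.
pose F k := homog n (path_poly (n - k) * strip_poly k.+1 predT (predC1 e) (predC1 e)).
rewrite -(sum_arcs (F := F)) => [|k lt_kn]; first by apply: eq_bigr => k _; rewrite homogMn.
rewrite /F (_ : n - k = (n - k.+1).+1)%N; last lia.
rewrite -{1}(subnK lt_kn) homogM ?size_path_poly ?size_strip_poly //.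
Qed.

(** * Solving the equations in terms of x and u *)

Lemma y_path_gf_0 : u 0%N = 0.
Proof. by rewrite fps_coefXM. Qed.

Lemma strip_gf_bool M L R :
  strip_gf M L R = 1 + x * y * strip_gf M predT R
    + u * ((if M true && L true then strip_gf M (predC1 true) R - (~~ R true)%:R else 0)
         + (if M false && L false then strip_gf M (predC1 false) R - (~~ R false)%:R else 0)).
Proof. by rewrite {1}strip_gf_eq big_mkcond big_bool. Qed.

Lemma path_gf_functional : u = y * (1 + u) * (1 + (1 + x) * u).
Proof. by rewrite {1}path_gf_eq weak_path_gf_eq; ring. Qed.

(** Implicit differentiation of the functional equation for u. *)
Lemma deriv_path_gf :
  y * fps_deriv u * (1 - y * (1 + (1 + x) * u + (1 + u) * (1 + x))) = u.
Proof.
have := path_gf_functional; move: u => f hf.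
have df : fps_deriv f = (1 + f) * (1 + (1 + x) * f)
    + y * (fps_deriv f * (1 + (1 + x) * f) + (1 + f) * ((1 + x) * fps_deriv f)).
  rewrite {1}hf !(fps_derivM, fps_derivD, fps_derivX, fps_deriv1, fps_derivC).
  by ring.
transitivity (y * (fps_deriv f
    - y * (fps_deriv f * (1 + (1 + x) * f) + (1 + f) * ((1 + x) * fps_deriv f)))).
  by ring.
by rewrite {1}df addrK [RHS]hf; ring.
Qed.

Lemma double_path_gf :
  strip_gf predT predT predT * (1 - u - x * y * (1 + u)) = 1 + u.
Proof.
apply: (double_path_gf_eq (E := strip_gf predT (predC1 true) predT)
                          (E' := strip_gf predT (predC1 false) predT)).
- by rewrite {1}strip_gf_bool /= !subr0.
- by rewrite {1}strip_gf_bool /= subr0 add0r.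
- by rewrite {1}strip_gf_bool /= subr0 addr0.
Qed.

Lemma cis_gf e :
  strip_gf predT predT (predC1 e) * (1 - u - x * y * (1 + u)) = 1
  /\ strip_gf predT (predC1 e) (predC1 e) * (1 - u ^+ 2)
     = (1 + x * y * strip_gf predT predT (predC1 e)) * (1 + u) - u ^+ 2.
Proof.
apply: (cis_gf_eq (T := strip_gf predT (predC1 (~~ e)) (predC1 e))).
- by rewrite {1}strip_gf_bool; case: e; rewrite /= subr0 //; congr (_ + _ * _); rewrite addrC.
- by rewrite {1}strip_gf_bool; case: e; rewrite /= subr0 ?add0r ?addr0.
- by rewrite {1}strip_gf_bool; case: e; rewrite /= ?add0r ?addr0.
Qed.

Let delta := 1 - u - x * y * (1 + u).

Let delta_unit : delta \is a GRing.unit.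
Proof.
apply: fps_unit1; rewrite !fps_coefB -mulrA fps_coefCM !fps_coefXM.
by rewrite mulr0 !subr0.
Qed.

Let unit_1u2 : 1 - u ^+ 2 \is a GRing.unit.
Proof. by apply: fps_unit_1B; rewrite expr2 fps_coefM0 y_path_gf_0 mul0r. Qed.

(** The equations of [cis_gf] have coefficients independent of the sign, and these are units; this
    stands in for the symmetry exchanging the signs. *)
Lemma cis_gf_sym e e' :
  strip_gf predT (predC1 e) (predC1 e) = strip_gf predT (predC1 e') (predC1 e').
Proof.
have [He Ce] := cis_gf e; have [He' Ce'] := cis_gf e'.
apply: (mulIr unit_1u2); rewrite Ce Ce'; congr ((1 + _ * _) * _ - _).
by apply: (mulIr delta_unit); rewrite He He'.
Qed.

Lemma cycle_gf_double_path : cycle_gf = strip_gf predT predT predT.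
Proof.
have := weak_path_gf_eq; set W := strip_gf _ _ _ => hW.
have hq : 1 - x * y * (1 + u) \is a GRing.unit.
  by apply: fps_unit_1B; rewrite -mulrA fps_coefCM fps_coefXM mulr0.
have hd : 1 - y * (W + (1 + u) * (1 + x)) \is a GRing.unit.
  by apply: fps_unit_1B; rewrite fps_coefXM.
apply: (cycle_double_path_eq hq hd delta_unit _ hW _ _ cycle_gf_eq double_path_gf).
- by rewrite hW; exact: path_gf_functional.
- by rewrite hW; exact: deriv_path_gf.
set Z := strip_gf _ _ _.
(* With one sign only, excluding it from the first position leaves that position avoided; hence Z (1
   - x y (1 + u)) = 1. *)
have hC : strip_gf (pred1 true) (predC1 true) (predC1 true) = 1 + x * y * Z.
  by rewrite strip_gf_bool /= addr0 mulr0 addr0.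
have hZ : Z = 1 + x * y * Z + u * (x * y * Z).
  by rewrite {1}/Z strip_gf_bool /= hC addr0 [X in X - 1]addrC addrK.
transitivity (Z - (x * y * Z + u * (x * y * Z))); first by ring.
by rewrite {1}hZ; ring.
Qed.

Definition cis_series := strip_gf predT (predC1 false) (predC1 false).

Lemma double_cycle_gf_cycle :
  double_cycle_gf = 1 + (x * y + 2%:R * y) * cycle_gf
    + 2%:R * y * (path_gf + y * fps_deriv path_gf) * (cis_series - 1).
Proof.
rewrite double_cycle_gf_eq -cycle_gf_double_path big_bool /= (cis_gf_sym true false).
rewrite fps_derivM fps_derivX /cis_series; ring.
Qed.

(** * Specialization at x = 0 *)

Lemma at_x0D f g : at_x0 (f + g) = at_x0 f + at_x0 g.
Proof. by apply/fpsP => n; rewrite /= hornerD. Qed.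

Lemma at_x0N f : at_x0 (- f) = - at_x0 f.
Proof. by apply/fpsP => n; rewrite /= hornerN. Qed.

Lemma at_x0M f g : at_x0 (f * g) = at_x0 f * at_x0 g.
Proof.
apply/fpsP => n; rewrite fps_coefM -[LHS]/((f * g) n).[0] fps_coefM horner_sum.
by apply: eq_bigr => i _; rewrite hornerM.
Qed.

Lemma at_x0_1 : at_x0 1 = 1.
Proof. by apply/fpsP => n; rewrite -[LHS]/((1 : fps {poly rat}) n).[0] !fps_coef1; case: eqP; rewrite hornerE. Qed.

Lemma at_x0_x : at_x0 x_var = 0.
Proof. by apply/fpsP => -[|n]; rewrite /= hornerE. Qed.

Lemma at_x0_y : at_x0 fpsX = fpsX.
Proof. by apply/fpsP => n; rewrite /=; case: eqP; rewrite hornerE. Qed.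

(* At x = 0 every series is a rational function of u = y (1 + u) ^ 2, and
   sqrt (1 - 4 y) = (1 - u) / (1 + u). *)
Lemma at_x0_solution (f v D H C : fps {poly rat})
    (z := fpsX : fps rat) (s := fps_sqrt (1 - 4%:R * z)) :
    f 0%N = 0 -> f = y * (1 + f) * (1 + (1 + x) * f) ->
    v * (1 - y * (1 + (1 + x) * f + (1 + f) * (1 + x))) = f ->
    D * (1 - f - x * y * (1 + f)) = 1 + f ->
    C * (1 - f ^+ 2) = (1 + x * y * H) * (1 + f) - f ^+ 2 ->
  at_x0 (1 + (x * y + 2%:R * y) * D + 2%:R * v * (C - 1))
  = 1 + (1 - s - 2%:R * z) / (1 - 4%:R * z) + 2%:R * z / s.
Proof.
move=> f0 hf hv hD hC.
pose morph := (at_x0M, at_x0N, at_x0D, at_x0_1, at_x0_x, at_x0_y).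
set w := at_x0 f; have w0 : w 0%N = 0 by rewrite /= f0 horner0.
have {hf} wE : w = z * (1 + w) ^+ 2.
  by rewrite {1}/w hf !morph -/w -/z; ring.
have pU : 1 - w \is a GRing.unit by apply: fps_unit_1B.
have qU : 1 + w \is a GRing.unit by apply: fps_unit1; rewrite fps_coefD w0 addr0.
(* The inverses are treated as variables subject to [pt] and [qr], so that [ring] can finish each
   computation. *)
pose t := (1 - w)^-1; pose r := (1 + w)^-1.
have pt : (1 - w) * t = 1 by apply: mulrV.
have qr : (1 + w) * r = 1 by apply: mulrV.
have zE : z = w * r ^+ 2.
  by rewrite wE -mulrA -exprMn qr expr1n mulr1.
have dE : 1 - 4%:R * z = ((1 - w) * r) ^+ 2.
  rewrite zE; transitivity (((1 + w) * r) ^+ 2 - 4%:R * (w * r ^+ 2)); first by rewrite qr expr1n.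
  by ring.
have r0 : r 0%N = 1.
  by have /fpsP/(_ 0%N) := qr; rewrite fps_coefM0 fps_coefD w0 addr0 mul1r.
have sE : s = (1 - w) * r.
  have z0 : (1 - 4%:R * z) 0%N = 1 by rewrite fps_coefB mulrC fps_coefXM subr0.
  apply: fps_sqrt_uniq; rewrite ?fps_sqrt0 //.
    by rewrite fps_coefM0 fps_coefB w0 r0 subr0 mulr1.
  by rewrite fps_sqrtK ?dE // -dE.
have sV : ((1 - w) * r)^-1 = (1 + w) * t.
  by rewrite invrM ?unitrV // invrK.
have {}hD : at_x0 D = (1 + w) * t.
  have := congr1 at_x0 hD; rewrite !morph !mul0r subr0 -/w => <-.
  by rewrite -mulrA pt mulr1.
have {}hv : at_x0 v = w * (1 + w) * t.
  have := congr1 at_x0 hv; rewrite !morph -/w -/z => hv'.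
  have {}hv' : at_x0 v * (1 - w) = w * (1 + w).
    (* Multiplying by 1 + w makes z (1 + w)^2 appear, which is w. *)
    transitivity (at_x0 v * (1 + w - 2%:R * (z * (1 + w) ^+ 2))); first by rewrite -wE; ring.
    transitivity (at_x0 v * (1 - z * (1 + (1 + 0) * w + (1 + w) * (1 + 0))) * (1 + w)).
      by ring.
    by rewrite hv'.
  by rewrite -hv' -mulrA pt mulr1.
(* [H] carries the factor x and disappears, which leaves C (1 - w^2) = 1 + w - w^2. *)
have {}hC : at_x0 C - 1 = w * t * r.
  have := congr1 at_x0 hC; rewrite expr2 !morph -/w !mul0r addr0 mul1r => hC'.
  have {}hC' : (at_x0 C - 1) * ((1 - w) * (1 + w)) = w.
    transitivity (at_x0 C * (1 - w * w) - (1 - w * w)); first by ring.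
    by rewrite hC'; ring.
  transitivity ((at_x0 C - 1) * (((1 - w) * t) * ((1 + w) * r))).
    by rewrite pt qr !mulr1.
  by rewrite -[in RHS]hC'; ring.
rewrite !morph hD hv hC -/z mul0r add0r sE dE -exprVn sV zE.
(* The terms 2 z D and 2 z / s agree; what remains is (1 - s - 2 z) / (1 - 4 z) = 2 w^2 / (1 -
   w)^2. *)
transitivity (1 + 2%:R * (w * r ^+ 2) * ((1 + w) * t) + 2%:R * w ^+ 2 * t ^+ 2).
  transitivity (1 + 2%:R * (w * r ^+ 2) * ((1 + w) * t)
     + 2%:R * w ^+ 2 * t ^+ 2 * ((1 + w) * r)); first by ring.
  by rewrite qr mulr1.
transitivity (1 + ((1 + w) ^+ 2 - (1 - w) * (1 + w) * ((1 + w) * r)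
   - 2%:R * w * ((1 + w) * r) ^+ 2) * t ^+ 2 + 2%:R * (w * r ^+ 2) * ((1 + w) * t)).
  by rewrite qr; ring.
by ring.
Qed.

Lemma double_cycle_gf_at_x0 (z := fpsX : fps rat) (s := fps_sqrt (1 - 4%:R * z)) :
  at_x0 double_cycle_gf
  = 1 + (1 - s - 2%:R * z) / (1 - 4%:R * z) + 2%:R * z / s.
Proof.
rewrite -(at_x0_solution y_path_gf_0 path_gf_functional deriv_path_gf double_path_gf (cis_gf false).2).
rewrite double_cycle_gf_cycle cycle_gf_double_path fps_derivM fps_derivX.
by congr at_x0; rewrite /cis_series; ring.
Qed.

End GeneratingFunctions.

(** * Polytopes *)

From mathcomp Require Import all_classical all_reals.

Section Faces.
Variable R : realType.

(** The rows of [A'] are differences of vectors from p to points of F, so they lie in the span of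
    [A]. Hence the dimension of a face is unique, and faces of dimension k come from simplices of
    size n - k only. *)
Lemma affine_dim_le d (F : set 'rV[R]_d) k k' :
  affine_dim F k -> affine_dim F k' -> (k' <= k)%N.
Proof.
move=> [p [A [Fp FA fA spanA]]] [p' [A' [Fp' FA' fA' _]]].
move: fA fA'; rewrite /row_free => /eqP rA /eqP rA'.
rewrite -rA -rA'; apply: mxrankS; apply/row_subP => i.
rewrite (_ : row i A' = (p' + row i A' - p) - (p' - p)).
  by rewrite addmx_sub ?eqmx_opp ?spanA.
by rewrite opprB addrA subrK [p' + _]addrC addrK.
Qed.

Lemma nfaces_simple_dual (V : finType) (K : pred {set V}) n (P : polytope R) k :
  simple_dual_to K n P -> (k <= n)%N ->
  nfaces P k = #|[set S | K S & #|S| == (n - k)%N]|.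
Proof.
move=> [phi [[phiF phi_inj phi_surj] _ phi_dim]] kn.
pose D := [set S | K S & #|S| == (n - k)%N].
have DK S : S \in D -> K S by rewrite inE => /andP[].
have inj : {in D &, injective phi}.
  by move=> S S' /DK KS /DK KS'; apply: phi_inj; rewrite inE.
(* [fset_set] is meaningful on finite sets only; finiteness comes from writing the faces as the
   image of [D]. *)
rewrite /nfaces (_ : [set F | _ /\ _]%classic = [set` [fset phi S | S in D]%fset]%classic).
  rewrite set_fsetK card_in_imfset //= cardE; apply: perm_size.
  by apply: uniq_perm => [||S]; rewrite ?enum_finmem_uniq ?enum_uniq // enum_finmemE mem_enum.
apply/seteqP; split=> F /=.
  case=> /phi_surj[S /= KS <-] FS; apply/imfsetP; exists S => //=.
  have [l lS Sl] := phi_dim S KS; have := affine_dim_le FS Sl; have := affine_dim_le Sl FS.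
  by rewrite inE KS => ? ?; apply/eqP; lia.
case/imfsetP => S /=; rewrite inE => /andP[KS /eqP cS] ->; split; first exact: phiF.
have [l lS] := phi_dim S KS; by rewrite (_ : l = k) //; lia.
Qed.

Lemma fpoly_simple_dual (V : finType) (c : rel V) (F : {set V}) (K : pred {set V})
    (P : nat -> polytope R) n :
    (forall N, K N = (N \in cliques c F)) -> simple_dual_to K n (P n) ->
  fpoly P n = homog n (clique_poly c F).
Proof.
move=> KE dual; apply/polyP => i; rewrite coef_homog /= coef_sum.
case: leqP => [le_in|lt_ni]; last first.
  apply: big1 => k _; rewrite coefZ coefXn; case: eqP => [ik|]; last by rewrite mulr0.
  by have := ltn_ord k; rewrite -ik ltnS leqNgt lt_ni.
rewrite (bigD1 (Ordinal (le_in : (i < n.+1)%N))) //= coefZ coefXn eqxx mulr1.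
rewrite big1 ?addr0 => [|k].
  rewrite (nfaces_simple_dual dual le_in) coef_clique_poly.
  by congr _%:R; apply: eq_card => N; rewrite !inE KE inE.
by rewrite -val_eqE /= => ki; rewrite coefZ coefXn eq_sym (negPf ki) mulr0.
Qed.

End Faces.

Lemma fpoly_double_cycle (R : realType) (P : nat -> polytope R) :
    (forall n, is_hypercube_graph_associahedron (double_cycle n) (P n)) ->
  fpoly P = double_cycle_gf.
Proof.
move=> dual; apply/fpsP => n.
exact: fpoly_simple_dual (@hc_tubing_cliques n (double_cycle n)) (dual n).
Qed.

Lemma fpoly_associahedra (R : realType) (P : nat -> polytope R) :
  (forall n, is_associahedron n (P n)) -> fpoly P = path_gf.
Proof.
move=> dual; apply/fpsP => n.
exact: fpoly_simple_dual (@graph_tubing_cliques _ (path_graph n.+1)) (dual n).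
Qed.

Lemma fpoly_cyclohedra (R : realType) (P : nat -> polytope R) :
  (forall n, is_cyclohedron n (P n)) -> fpoly P = cycle_gf.
Proof.
move=> dual; apply/fpsP => n.
exact: fpoly_simple_dual (@graph_tubing_cliques _ (cycle_graph n.+1)) (dual n).
Qed.

Lemma fpoly_cisE : fpoly_cis = cis_series.
Proof.
apply/fpsP => -[|n]; first by rewrite /= strip_poly0 homog1.
rewrite /= /homog; apply: eq_bigr => k _; rewrite coef_clique_poly; congr (_%:R *: _).
by apply: eq_card => N; rewrite [LHS]inE [RHS]inE cis_tubing_cliques.
Qed.

Lemma at_x0_fpoly (R : realType) (P : nat -> polytope R) :
  at_x0 (fpoly P) = Fps (fun n => (nfaces (P n) 0)%:R).
Proof.
apply/fpsP => n; rewrite /= horner_sum big_ord_recl big1 ?addr0 => [|k _].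
  by rewrite !hornerE.
by rewrite hornerZ hornerXn expr0n mulr0.
Qed.

Theorem proposition6p1p25 (R : realType) (DC A B : nat -> polytope R)
  (hDC : forall n : nat,
     is_hypercube_graph_associahedron (double_cycle n) (DC n))
  (hA : forall n : nat, is_associahedron n (A n))
  (hB : forall n : nat, is_cyclohedron n (B n)) :
  (let x : fps {poly rat} := x_var in
   let y : fps {poly rat} := fpsX in
   fpoly DC = 1 + (x * y + 2%:R * y) * fpoly B
              + 2%:R * y * (fpoly A + y * fps_deriv (fpoly A))
                * (fpoly_cis - 1))
  /\
  (let y : fps rat := fpsX in
   let s : fps rat := fps_sqrt (1 - 4%:R * y) in
   at_x0 (fpoly DC) = Fps (fun n => (nfaces (DC n) 0)%:R) /\
   at_x0 (fpoly DC)
     = 1 + (1 - s - 2%:R * y) / (1 - 4%:R * y) + 2%:R * y / s).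
Proof.
split=> [x y|y s].
  rewrite (fpoly_double_cycle hDC) (fpoly_associahedra hA) (fpoly_cyclohedra hB) fpoly_cisE.
  exact: double_cycle_gf_cycle.
split; first exact: at_x0_fpoly.
by rewrite (fpoly_double_cycle hDC); exact: double_cycle_gf_at_x0.
Qed.
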